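(* Let $1\le s\le n$ be such that $\mathfrak G(n,s)\neq\emptyset$. If $\Gamma$ is an element of $\mathfrak G(n,s)$ taken uniformly at random, then $\mathrm{silh}(\Gamma)$ is a uniformly random element of $\mathfrak D(s,s)$. That is, for any $\Delta,\Delta'\in\mathfrak D(s,s)$, $$\mathbb P(\mathrm{silh}(\Gamma)=\Delta)=\mathbb P(\mathrm{silh}(\Gamma)=\Delta'),$$ where $\Gamma$ is the $\mathfrak G(n,s)$-valued random variable with uniform distribution.
   Context: A $\mathrm{PSL}_2(\mathbb Z)$-cyclically reduced graph is a finite connected graph with undirected $a$-edges and directed $b$-edges such that: every vertex lies on exactly one $a$-edge, which is either an $a$-loop or an isolated $a$-edge (joining two distinct vertices); the $b$-edges form a partial injective map on vertices, every vertex lies on a $b$-edge, and each $b$-edge is a $b$-loop, or an isolated $b$-edge (joining two distinct vertices lying on no other $b$-edge), or one of the edges of a $b$-triangle (a directed 3-cycle on three distinct vertices). Its size is its number of vertices. It is labeled if its vertex set of size $n$ is $[n]=\{1,\dots,n\}$, and quasi-labeled if its vertices are distinct positive integers. $\mathrm{norm}(\Gamma)$ is the labeled graph obtained from a quasi-labeled graph $\Gamma$ by the order-preserving relabeling onto $\{1,\dots,|\Gamma|\}$. Special graphs: $\Delta_1$ has one vertex carrying an $a$-loop and a $b$-loop; $\Delta_2$ has two vertices joined by an isolated $a$-edge and by an isolated $b$-edge; $\Delta_3$ has two vertices joined by an isolated $b$-edge, each carrying an $a$-loop. Moves on a quasi-labeled cyclically reduced graph (deleting a vertex also deletes its adjacent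 edges): - $\lambda_3$: if $v$ carries a $b$-loop and an isolated $a$-edge joins $v$ to $w\ne v$, delete $v$ and add an $a$-loop at $w$. - $\lambda_{2,1}$: if $v$ carries an $a$-loop and lies on a $b$-triangle $w\to v\to w'\to w$, delete $v$ (the $b$-edge $w'\to w$ becomes isolated). - $\lambda_{2,2}$: if $v$ carries an $a$-loop, an isolated $b$-edge (of either orientation) joins $v$ and $w\ne v$, and an isolated $a$-edge joins $w$ to $w'\notin\{v,w\}$, delete $v$ and $w$ and add an $a$-loop at $w'$. - $\kappa_3$: if there is an isolated $b$-edge $v\to w$, and isolated $a$-edges join $v$ to $v'$ and $w$ to $w'$ with $v,w,v',w'$ pairwise distinct, delete $v$ and $w$ and add an isolated $a$-edge between $v'$ and $w'$. - $\mathrm{exc}$: if the graph is $\Delta_3$ with $b$-edge $v\to w$, replace it by $\Delta_1$ with vertex $v$. The quasi-silhouette $\mathrm{q\text{-}silh}(\Gamma)$ of a labeled cyclically reduced graph $\Gamma$ is the quasi-labeled graph obtained by applying a maximal sequence of moves. The result does not depend on the sequence, except for the vertex labels in two situations, where the following conventions are adopted: if $\Gamma$ is a $b$-triangle with three $a$-loops, the first $\lambda_{2,1}$-move keeps the $b$-edge with maximal start vertex; if $\Gamma$ is a single cycle alternating $a$-edges and isolated $b$-edges (with at least two $b$-edges), the $\kappa_3$-moves eliminate all $b$-edges except the one with maximal start vertex. These situations lead to $\Delta_1$ and $\Delta_2$ respectively. The silhouette is $\mathrm{silh}(\Gamma)=\mathrm{norm}(\mathrm{q\text{-}silh}(\Gamma))$.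 It is either $\Delta_1$, or $\Delta_2$, or a graph with no loops and no isolated $b$-edges. $\mathfrak G(n,s)$ is the set of size $n$ labeled $\mathrm{PSL}_2(\mathbb Z)$-cyclically reduced graphs whose silhouette has $s$ vertices; $\mathfrak D(n,s)=\{\mathrm{q\text{-}silh}(\Gamma):\Gamma\in\mathfrak G(n,s)\}$. In particular $\mathfrak D(s,s)$ is the set of labeled silhouettes of size $s$. Convention: the silhouettes $\Delta_1$ and $\Delta_2$ are considered without regard to their vertex labels, so that there is exactly one silhouette of size 1 and exactly one of size 2. *)

(* Defs.v *)
From HB Require Import structures.
From mathcomp Require Import all_boot all_order all_algebra.
From mathcomp Require Export finmap.
From mathcomp Require Import boolp classical_sets.
From Stdlib Require Import Relation_Operators.

Set Implicit Arguments.
Unset Strict Implicit.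
Unset Printing Implicit Defensive.

Local Open Scope fset_scope.

(* An undirected a-edge is the set of its endpoints, so the a-loop at v is
   [fset v]; a directed b-edge v -> w is the pair (v, w). *)
Record graph := Graph {
  verts : {fset nat};
  aedges : {fset {fset nat}};
  bedges : {fset nat * nat}
}.

Definition graph_tuple (G : graph) := (verts G, aedges G, bedges G).
Definition tuple_graph (t : {fset nat} * {fset {fset nat}} * {fset nat * nat}) :=
  Graph t.1.1 t.1.2 t.2.
Lemma graph_tupleK : cancel graph_tuple tuple_graph.
Proof. by case. Qed.
HB.instance Definition _ := Equality.copy graph (can_type graph_tupleK).
HB.instance Definition _ := Choice.copy graph (can_type graph_tupleK).

Definition a_loop (G : graph) (v : nat) : Prop := [fset v] \in aedges G.

Definition a_isolated (G : graph) (v w : nat) : Prop :=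
  v <> w /\ [fset v; w] \in aedges G.

Definition b_loop (G : graph) (v : nat) : Prop := (v, v) \in bedges G.

Definition b_isolated (G : graph) (v w : nat) : Prop :=
  [/\ v <> w, (v, w) \in bedges G &
      forall e, e \in bedges G ->
        [|| e.1 == v, e.1 == w, e.2 == v | e.2 == w] -> e = (v, w)].

Definition b_triangle (G : graph) (u v w : nat) : Prop :=
  [/\ uniq [:: u; v; w], (u, v) \in bedges G, (v, w) \in bedges G
    & (w, u) \in bedges G].

Definition adjacent (G : graph) : rel nat := fun v w =>
  [|| [fset v; w] \in aedges G, (v, w) \in bedges G | (w, v) \in bedges G].

Definition connected (G : graph) : Prop :=
  verts G <> fset0 /\
  forall v w, v \in verts G -> w \in verts G ->
    exists p : seq nat, path (adjacent G) v p /\ last v p = w.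

Definition a_wf (G : graph) : Prop :=
  (forall e, e \in aedges G ->
     e `<=` verts G /\ (#|` e| = 1 \/ #|` e| = 2)) /\
  (forall v, v \in verts G -> exists! e, e \in aedges G /\ v \in e).

Definition b_wf (G : graph) : Prop :=
  [/\ forall v w, (v, w) \in bedges G -> v \in verts G /\ w \in verts G,
      (forall v w w', (v, w) \in bedges G -> (v, w') \in bedges G -> w = w') /\
      (forall v v' w, (v, w) \in bedges G -> (v', w) \in bedges G -> v = v'),
      forall v, v \in verts G ->
        exists w, (v, w) \in bedges G \/ (w, v) \in bedges G
    & forall v w, (v, w) \in bedges G ->
        [\/ v = w, b_isolated G v w | exists u, b_triangle G v w u]].

Definition cyc_reduced (G : graph) : Prop := [/\ connected G, a_wf G & b_wf G].

Definition Delta1 (v : nat) : graph :=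
  Graph [fset v] [fset [fset v]] [fset (v, v)].

Definition Delta2 (v w : nat) : graph :=
  Graph [fset v; w] [fset [fset v; w]] [fset (v, w)].

Definition Delta3 (v w : nat) : graph :=
  Graph [fset v; w] [fset [fset v]; [fset w]] [fset (v, w)].

Definition del_verts (U : {fset nat}) (G : graph) : graph :=
  Graph (verts G `\` U)
        [fset e in aedges G | e `&` U == fset0]
        [fset e in bedges G | (e.1 \notin U) && (e.2 \notin U)].

Definition add_aedge (e : {fset nat}) (G : graph) : graph :=
  Graph (verts G) (e |` aedges G) (bedges G).

Definition lambda3 (G G' : graph) : Prop := exists v w,
  [/\ b_loop G v, a_isolated G v w
    & G' = add_aedge [fset w] (del_verts [fset v] G)].

Definition lambda21 (G G' : graph) : Prop := exists v w w',
  [/\ a_loop G v, b_triangle G w v w' & G' = del_verts [fset v] G].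

Definition lambda22 (G G' : graph) : Prop := exists v w w',
  [/\ a_loop G v,
      b_isolated G v w \/ b_isolated G w v,
      a_isolated G w w' /\ uniq [:: v; w; w']
    & G' = add_aedge [fset w'] (del_verts [fset v; w] G)].

Definition kappa3 (G G' : graph) : Prop := exists v w v' w',
  [/\ b_isolated G v w,
      a_isolated G v v' /\ a_isolated G w w',
      uniq [:: v; w; v'; w']
    & G' = add_aedge [fset v'; w'] (del_verts [fset v; w] G)].

Definition exc (G G' : graph) : Prop := exists v w,
  [/\ v <> w, G = Delta3 v w & G' = Delta1 v].

Definition move (G G' : graph) : Prop :=
  lambda3 G G' \/ lambda21 G G' \/ lambda22 G G' \/ kappa3 G G' \/ exc G G'.

Definition reduces : graph -> graph -> Prop := clos_refl_trans_1n graph move.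

Definition max_start (G : graph) (e : nat * nat) : Prop :=
  e \in bedges G /\ forall f, f \in bedges G -> (f.1 <= e.1)%N.

Definition looped_triangle (G : graph) : Prop := exists u v w,
  [/\ verts G = [fset u; v; w], b_triangle G u v w
    & [/\ a_loop G u, a_loop G v & a_loop G w]].

(* The entry (x, y) of c is an isolated b-edge traversed from x to y, against
   its direction if needed. *)
Definition alternating_cycle (G : graph) : Prop := exists c : seq (nat * nat),
  [/\ (1 < size c)%N,
      uniq (flatten [seq [:: p.1; p.2] | p <- c]),
      verts G =i flatten [seq [:: p.1; p.2] | p <- c],
      forall p, p \in c -> b_isolated G p.1 p.2 \/ b_isolated G p.2 p.1
    & cycle (fun p q => [fset p.2; q.1] \in aedges G) c].

Definition is_qsilh (G D : graph) : Prop :=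
  [/\ reduces G D,
      forall D', ~ move D D',
      looped_triangle G -> exists e G1,
        [/\ max_start G e, lambda21 G G1, bedges G1 = [fset e] & reduces G1 D]
    & alternating_cycle G -> exists e, max_start G e /\ bedges D = [fset e]].

(* Every move deletes a vertex, so is_qsilh G is inhabited for every
   cyclically reduced G, and the default value is not used there.  A chosen
   result is needed because two maximal sequences of moves may end in copies of
   Delta1, or of Delta2, on different vertices. *)
Definition qsilh (G : graph) : graph := xget G (is_qsilh G).

Definition rank (V : {fset nat}) (v : nat) : nat :=
  #|` [fset u in V | (u <= v)%N]|.

Definition relabel (f : nat -> nat) (G : graph) : graph :=
  Graph [fset f v | v in verts G]
        [fset [fset f v | v in (e : {fset nat})] | e in aedges G]
        [fset (f e.1, f e.2) | e in bedges G].

Definition norm (G : graph) : graph := relabel (rank (verts G)) G.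

Definition silh (G : graph) : graph := norm (qsilh G).

Definition graphs_on (V : {fset nat}) : {fset graph} :=
  [fset Graph V p.1 p.2
     | p in fpowerset (fpowerset V) `*` fpowerset (V `*` V)].

Definition labels (n : nat) : {fset nat} := [fset i in iota 1 n].

Definition frakG (n s : nat) : {fset graph} :=
  [fset G in graphs_on (labels n)
     | `[< cyc_reduced G >] && (#|` verts (silh G)| == s)].

Definition frakD (n s : nat) : {fset graph} := [fset qsilh G | G in frakG n s].

(* Equality of silhouettes when the vertex labels of Delta1 and Delta2 are
   disregarded. *)
Definition same_silh (D D' : graph) : Prop :=
  [\/ D = D',
      exists v v', D = Delta1 v /\ D' = Delta1 v'
    | exists v w v' w', [/\ v <> w, v' <> w', D = Delta2 v w & D' = Delta2 v' w']].

Definition unif_prob (T : choiceType) (A : {fset T}) (E : T -> Prop) : rat :=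
  (#|` [fset x in A | `[< E x >]]|%:R / #|` A|%:R)%R.

(* Main.v *)
Require Import Defs.
From mathcomp Require Import all_boot all_order all_algebra finmap.
From mathcomp Require Import boolp classical_sets zify.
From Stdlib Require Import Relation_Operators.

(* Away from exc, a move deletes a set U of vertices and inserts at most one
   a-edge.  Two such moves on a connected graph commute or have a common
   reduct, unless both results have at most two vertices; so a normal form with
   s > 2 vertices is unique.  Such a normal form E has only isolated a-edges and
   b-triangles, and the triangles are already present in the graph G it comes
   from.  If E' is another silhouette on the vertex set of E, a permutation of
   that set carrying the a-edges of E to those of E', followed by the
   replacement of the b-triangles of E by those of E', turns G into a graph with
   quasi-silhouette E' : the deleted vertices never lie on those triangles, so
   every move is carried along.  This map is injective, and by symmetry the
   fibres over two silhouettes of size s have the same cardinality.  For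
   s <= 2 there is only one silhouette up to labels. *)

Set Implicit Arguments.
Unset Strict Implicit.
Unset Printing Implicit Defensive.

Local Open Scope fset_scope.

(** * Adjacency and well-formedness *)

(** The two kinds of edges of E behave differently under reduction. Away from [exc] no move creates
    a b-edge, so the b-edges of E can be replaced inside G. Its a-edges may have been inserted by
    kappa3-moves, and then G has nothing to replace. But they form a perfect matching of the
    vertices of E, and any two perfect matchings of a finite set are conjugate under a permutation.
    A permutation alone would not do, since E and E' need not be isomorphic.

    Connectedness of the new graph cannot be read off from G. It is pulled back along the moves from
    E', which is why its behaviour under a move is proved as an equivalence, and for graphs known
    only to satisfy the local conditions.

    One fibre contains graphs whose quasi-silhouettes lie on many vertex sets, so the transfer is
    chosen separately for each quasi-silhouette. Images do not collide: the quasi-silhouette of an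
    image shows the vertex set of the original one, which together with the silhouette determines
    it. *)

Lemma fset2_eq (x y a b : nat) :
  [fset x; y] = [fset a; b] -> (x = a /\ y = b) \/ (x = b /\ y = a).
Proof.
move=> /fsetP E.
have := E x; have := E y; have := E a; have := E b.
rewrite !inE !eqxx ?orbT /=.
move=> /orP[] /eqP hb /orP[] /eqP ha /esym/orP[] /eqP hy /esym/orP[] /eqP hx;
  subst; auto.
Qed.

Lemma fset1_2 (x : nat) : [fset x; x] = [fset x].
Proof. exact: fsetUid. Qed.

(** For [x = y] this is the a-loop at [x], so loops and isolated a-edges become instances of one
    symmetric relation. *)
Definition anb (G : graph) x y := [fset x; y] \in aedges G.
Definition badj (G : graph) x y := ((x, y) \in bedges G) || ((y, x) \in bedges G).
Definition biso (G : graph) x y := b_isolated G x y \/ b_isolated G y x.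

Section Adjacency.
Variable G : graph.

Lemma anbC x y : anb G x y = anb G y x.
Proof. by rewrite /anb fsetUC. Qed.

Lemma badjC x y : badj G x y = badj G y x.
Proof. by rewrite /badj orbC. Qed.

Lemma bisoC x y : biso G x y <-> biso G y x.
Proof. by rewrite /biso; split=> -[]; auto. Qed.

Lemma adjacentE x y : adjacent G x y = anb G x y || badj G x y.
Proof. by []. Qed.

Lemma adjacentC x y : adjacent G x y = adjacent G y x.
Proof. by rewrite !adjacentE anbC badjC. Qed.

Lemma a_loopE x : a_loop G x = anb G x x.
Proof. by rewrite /a_loop /anb fset1_2. Qed.

Lemma biso_neq x y : biso G x y -> x <> y.
Proof. by case=> -[xy _ _] // /esym. Qed.

Lemma biso_badj x y : biso G x y -> badj G x y.
Proof. by rewrite /badj; case=> -[_ -> _]; rewrite ?orbT. Qed.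

Lemma biso_uniq x y z : biso G x y -> badj G x z -> z = y.
Proof.
by case=> -[xy _ H] /orP[] /H /=; rewrite !eqxx ?orbT => /(_ isT) [] *;
  subst.
Qed.

End Adjacency.

Lemma b_tri_rot G x y z : b_triangle G x y z -> b_triangle G y z x.
Proof.
case=> u xy yz zx; split=> //; move: u; rewrite /= !inE !negb_or.
by rewrite (eq_sym z x) (eq_sym y x) => /andP[/andP[-> ->] /andP[-> _]].
Qed.

Lemma b_tri_neq G x y z : b_triangle G x y z -> [/\ x <> y, y <> z & x <> z].
Proof.
case=> /= + _ _ _; rewrite !inE !negb_or andbT.
by case/andP=> /andP[/eqP ? /eqP ?] /eqP ?.
Qed.

Section BWf.
Variable G : graph.
Hypothesis wf : b_wf G.

Lemma bedge_fun x y z : (x, y) \in bedges G -> (x, z) \in bedges G -> y = z.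
Proof. by case: wf => _ [H _] _ _; exact: H. Qed.

Lemma bedge_inj x y z : (x, z) \in bedges G -> (y, z) \in bedges G -> x = y.
Proof. by case: wf => _ [_ H] _ _; exact: H. Qed.

Lemma bedge_verts x y : (x, y) \in bedges G -> x \in verts G /\ y \in verts G.
Proof. by case: wf => H _ _ _; exact: H. Qed.

Lemma badj_verts x y : badj G x y -> x \in verts G /\ y \in verts G.
Proof. by case/orP=> /bedge_verts[]. Qed.

Lemma b_loop_uniq x z : b_loop G x -> badj G x z -> z = x.
Proof. by move=> xx /orP[] H; [rewrite (bedge_fun H xx)|rewrite (bedge_inj H xx)]. Qed.

Lemma b_tri_badj x y z t : b_triangle G x y z -> badj G y t -> t = x \/ t = z.
Proof.
case=> _ xy yz zx /orP[] H; first by right; exact: bedge_fun H yz.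
by left; exact: bedge_inj H xy.
Qed.

Lemma b_loop_not_biso x y : b_loop G x -> ~ biso G x y.
Proof.
move=> xx h; apply: (biso_neq h); apply/esym.
exact: (b_loop_uniq xx (biso_badj h)).
Qed.

Lemma b_loop_not_tri x y z : b_loop G x -> ~ b_triangle G x y z.
Proof.
move=> xx h; have [n _ _] := b_tri_neq h; apply: n.
by case: h => _ xy _ _; exact: bedge_fun xx xy.
Qed.

Lemma biso_not_tri x y t z : biso G x t -> ~ b_triangle G x y z.
Proof.
move=> h tr; have [_ yz _] := b_tri_neq tr; apply: yz.
case: tr => _ xy _ zx.
have -> : y = t by apply: (biso_uniq h); rewrite /badj xy.
by apply/esym/(biso_uniq h); rewrite /badj zx orbT.
Qed.

Lemma b_tri_uniq x y z y' z' : b_triangle G x y z -> b_triangle G x y' z' ->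
  y = y' /\ z = z'.
Proof.
move=> [_ xy _ zx] [_ xy' _ zx']; split; first exact: bedge_fun xy xy'.
exact: bedge_inj zx zx'.
Qed.

End BWf.

Section AWf.
Variable G : graph.

(** Together with the symmetry of [anb], this says that [anb] is the graph of an involution of the
    vertex set; its fixed points carry the a-loops. *)
Definition a_wfr :=
  [/\ forall e, e \in aedges G -> exists x y, e = [fset x; y],
      forall x y, anb G x y -> x \in verts G,
      forall x, x \in verts G -> exists y, anb G x y
    & forall x y z, anb G x y -> anb G x z -> y = z].

Lemma a_wfP : a_wf G <-> a_wfr.
Proof.
split.
  move=> [He Hv]; split.
  - move=> e /He[_ []].
      by move/eqP/cardfs1P=> [x ->]; exists x, x; rewrite fset1_2.
    move=> c2.
    have /fset0Pn[x xe] : e != fset0 by rewrite -cardfs_gt0 c2.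
    have : #|` e `\ x| == 1.
      by have := cardfsD1 x e; rewrite xe c2 add1n => -[<-].
    case/cardfs1P=> y ey; exists x, y.
    by rewrite -(fsetD1K xe) ey.
  - by move=> x y /He[/fsubsetP + _]; apply; rewrite !inE eqxx.
  - move=> x /Hv[e [[ee xe] _]].
    have [_ c12] := He e ee.
    have c : (#|` e `\ x| <= 1)%N.
      by have := cardfsD1 x e; rewrite xe; case: c12 => -> ; lia.
    case: (fset_0Vmem (e `\ x)) => [e0|[y ye]].
      exists x; rewrite /anb fset1_2; suff -> : [fset x] = e by [].
      by rewrite -(fsetD1K xe) e0 fsetU0.
    exists y; rewrite /anb; suff -> : [fset x; y] = e by [].
    rewrite -(fsetD1K xe); congr (_ `|` _).
    apply/eqP; rewrite eqEfcard fsub1set ye cardfs1.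
    exact: c.
  - move=> x y z xy xz.
    have xv : x \in verts G.
      by have [/fsubsetP + _] := He _ xy; apply; rewrite !inE eqxx.
    have [e [_ U]] := Hv x xv.
    have E1 := U _ (conj xy (fset21 _ _)).
    have E2 := U _ (conj xz (fset21 _ _)).
    by have := E1; rewrite E2 => /fset2_eq[] [] *; subst.
move=> [H1 H2 H3 H4]; split.
  move=> e ee; have [x [y exy]] := H1 e ee; subst e.
  split.
    apply/fsubsetP=> t; rewrite !inE => /orP[]/eqP->; first exact: H2 ee.
    by apply: (H2 _ x); rewrite anbC.
  rewrite cardfs2; case: (x != y); [by right|by left].
move=> x /H3[y xy]; exists [fset x; y]; split.
  by split=> //; exact: fset21.
move=> e [ee xe]; have [p [q epq]] := H1 e ee; subst e.
move: xe; rewrite !inE => /orP[]/eqP ?; subst x.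
  by rewrite (H4 _ _ _ xy ee).
by rewrite fsetUC (H4 _ _ _ xy (etrans (anbC G q p) ee)).
Qed.

End AWf.

Definition closedp (G : graph) (P : nat -> Prop) :=
  forall x y, adjacent G x y -> P x -> P y.

(** Closed predicates replace paths: when vertices are deleted, a predicate is extended instead of a
    path being rerouted, and a closed set that contains one vertex bounds the whole vertex set. *)
Definition conn (G : graph) := verts G <> fset0 /\
  forall P, closedp G P -> forall x y, x \in verts G -> y \in verts G ->
  P x -> P y.

Lemma closedpE G P x y : closedp G P -> adjacent G x y -> P x <-> P y.
Proof. by move=> c xy; split; apply: c; rewrite // adjacentC. Qed.

Lemma connectedP G : connected G <-> conn G.
Proof.
split=> -[ne H]; split=> //.
  move=> P cP x y xv yv Px; have [p [pp <-]] := H x y xv yv.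
  elim: p x Px pp {xv H} => //= z p IH x Px /andP[xz pp].
  by apply: IH pp; exact: cP xz Px.
move=> v w vv wv.
apply: (H (fun y => exists p, path (adjacent G) v p /\ last v p = y) _ v) => //.
  move=> x y xy [p [pp lp]]; exists (rcons p y).
  by rewrite last_rcons rcons_path pp lp.
by exists [::].
Qed.

(** Kept apart from connectedness because, for an exchanged graph, the local conditions are known
    first and connectedness is deduced with their help. *)
Definition locwf G := a_wfr G /\ b_wf G.
Definition wf G := conn G /\ locwf G.

Lemma cyc_reducedP G : cyc_reduced G <-> wf G.
Proof.
rewrite /cyc_reduced (propext (connectedP G)) (propext (a_wfP G)).
by split=> [[] | [? []]].
Qed.

(** * Moves as vertex deletions *)

(** A common form for the results of all moves other than [exc]. It is stable under composition, so
    comparing two reducts amounts to comparing two deleted sets and two inserted sets. *)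
Definition cut (U : {fset nat}) (F : {fset {fset nat}}) (G : graph) : graph :=
  Graph (verts G `\` U) (F `|` [fset e in aedges G | e `&` U == fset0])
        [fset e in bedges G | (e.1 \notin U) && (e.2 \notin U)].

Lemma del_vertsE U G : del_verts U G = cut U fset0 G.
Proof. by rewrite /cut fset0U. Qed.

Lemma fset2_disjoint (x y : nat) (U : {fset nat}) :
  ([fset x; y] `&` U == fset0) = (x \notin U) && (y \notin U).
Proof.
apply/eqP/andP.
  move=> /fsetP E; split; apply/negP=> xU.
    by have := E x; rewrite !inE eqxx xU.
  by have := E y; rewrite !inE eqxx xU orbT.
move=> [xU yU]; apply/fsetP=> z; rewrite !inE.
apply/negbTE; apply/negP=> /andP[/orP[]/eqP-> H]; first by rewrite H in xU.
by rewrite H in yU.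
Qed.

Lemma anb_cut U F G x y :
  anb (cut U F G) x y =
  ([fset x; y] \in F) || [&& anb G x y, x \notin U & y \notin U].
Proof. by rewrite /anb /cut /= !inE /= fset2_disjoint. Qed.

Lemma bedge_cut U F G x y : ((x, y) \in bedges (cut U F G)) =
  [&& (x, y) \in bedges G, x \notin U & y \notin U].
Proof. by rewrite /cut /= !inE. Qed.

Lemma badj_cut U F G x y : badj (cut U F G) x y =
  [&& badj G x y, x \notin U & y \notin U].
Proof.
rewrite /badj !bedge_cut.
by case: (x \notin U); case: (y \notin U); rewrite ?andbF ?andbT.
Qed.

Lemma vert_cut U F G x :
  (x \in verts (cut U F G)) = (x \notin U) && (x \in verts G).
Proof. by rewrite /cut /= inE. Qed.

Lemma cut_cut U F U' F' G : cut U F (cut U' F' G) =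
  cut (U' `|` U) (F `|` [fset e in F' | e `&` U == fset0]) G.
Proof.
rewrite /cut /=; congr Graph; apply/fsetP=> e; rewrite !inE /= ?inE /=.
- by case: (e \in U); case: (e \in U').
- rewrite fsetIUr fsetU_eq0.
  by case: (e \in F); case: (e \in F'); case: (e \in aedges G) => //=;
  case: (e `&` U == _); case: (e `&` U' == _).
- rewrite !negb_or; case: (e \in bedges G) => //=.
  by case: (e.1 \in U); case: (e.2 \in U); case: (e.1 \in U');
     case: (e.2 \in U').
Qed.

(** The case of two independent moves: everything inserted by the first survives the second. *)
Lemma cut_cut_disjoint U F U' F' G : (forall e, e \in F' -> e `&` U = fset0) ->
  cut U F (cut U' F' G) = cut (U' `|` U) (F `|` F') G.
Proof.
move=> H; rewrite cut_cut; congr (cut _ (_ `|` _) _).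
apply/fsetP=> e; rewrite !inE /=; case eF: (e \in F') => //=.
by apply/eqP/H.
Qed.

(** The case of two overlapping moves: the second deletes an endpoint of every a-edge that the first
    inserted. *)
Lemma cut_cut_meet U F U' F' G : (forall e, e \in F' -> e `&` U <> fset0) ->
  cut U F (cut U' F' G) = cut (U' `|` U) F G.
Proof.
move=> H; rewrite cut_cut; congr (cut _ _ _).
apply/fsetP=> e; rewrite !inE /=; case eF: (e \in F'); last by rewrite orbF.
by rewrite (negbTE (introN eqP (H e eF))) orbF.
Qed.

Lemma b_loop_cut U F G x : b_loop G x -> x \notin U -> b_loop (cut U F G) x.
Proof. by rewrite /b_loop bedge_cut => -> ->. Qed.

Lemma b_iso_cut U F G x y : b_isolated G x y -> x \notin U -> y \notin U ->
  b_isolated (cut U F G) x y.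
Proof.
case=> xy bxy H xU yU; split=> //; first by rewrite bedge_cut bxy xU yU.
by move=> [p q]; rewrite bedge_cut => /and3P[/H + _ _].
Qed.

Lemma biso_cut U F G x y : biso G x y -> x \notin U -> y \notin U ->
  biso (cut U F G) x y.
Proof. by case=> h xU yU; [left|right]; exact: b_iso_cut. Qed.

Lemma b_tri_cut U F G x y z : b_triangle G x y z ->
  x \notin U -> y \notin U -> z \notin U -> b_triangle (cut U F G) x y z.
Proof.
by case=> u xy yz zx xU yU zU; split=> //; rewrite bedge_cut ?xy ?yz ?zx ?xU ?yU ?zU.
Qed.

(* The moves other than exc, with [U] the deleted vertices, [F] the added
   a-edges and [S] all the vertices that the move mentions; the b-edge of a
   kappa3-move is taken with any orientation. *)
Inductive step (G : graph) :
  {fset nat} -> {fset nat} -> {fset {fset nat}} -> Prop :=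
| StepL3 v w of b_loop G v & v <> w & anb G v w :
    step G [fset v; w] [fset v] [fset [fset w]]
| StepL21 v w w' of anb G v v & b_triangle G w v w' :
    step G [fset w; v; w'] [fset v] fset0
| StepL22 v w w' of anb G v v & biso G v w & anb G w w' & v <> w' & w <> w' :
    step G [fset v; w; w'] [fset v; w] [fset [fset w']]
| StepK v w v' w' of biso G v w & anb G v v' & anb G w w' & v <> v' & v <> w'
    & w <> v' & w <> w' & v' <> w' :
    step G [fset v; w; v'; w'] [fset v; w] [fset [fset v'; w']].

Lemma uniq3P (x y z : nat) :
  uniq [:: x; y; z] <-> [/\ x <> y, x <> z & y <> z].
Proof.
rewrite /= !inE !negb_or andbT; split.
  by case/andP=> /andP[/eqP ? /eqP ?] /eqP ?.
by case=> /eqP-> /eqP-> /eqP->.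
Qed.

Lemma uniq4P (x y z t : nat) : uniq [:: x; y; z; t] <->
  [/\ x <> y, x <> z & x <> t] /\ [/\ y <> z, y <> t & z <> t].
Proof.
rewrite /= !inE !negb_or andbT; split.
  by case/and3P=> /and3P[/eqP ? /eqP ? /eqP ?] /andP[/eqP ? /eqP ?] /eqP ?.
by case=> -[/eqP-> /eqP-> /eqP->] [/eqP-> /eqP-> /eqP->].
Qed.

Lemma moveP G G' : move G G' <->
  (exists S U F, step G S U F /\ G' = cut U F G) \/ exc G G'.
Proof.
split.
  case; last case; last case; last case; last by right.
  - move=> [v [w [h [vw e] ->]]]; left; do 3 eexists; split; first exact: StepL3 h vw e.
    by [].
  - move=> [v [w [w' [h t ->]]]]; left; do 3 eexists; split.
      by apply: StepL21 t; rewrite -a_loopE.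
    exact: del_vertsE.
  - move=> [v [w [w' [h b [[ww' e] /uniq3P[u1 u2 u3]] ->]]]]; left.
    do 3 eexists; split; last by [].
    by apply: StepL22 e u2 u3 => //; rewrite -a_loopE.
  - move=> [v [w [v' [w' [b [[vv' e] [ww' e']] /uniq4P[[? ? ?] [? ? ?]] ->]]]]].
    left; do 3 eexists; split; last by [].
    by apply: StepK e e' _ _ _ _ _ => //; left.
case; last by do 4 right.
move=> [S [U [F [[] ]]]].
- by move=> v w h vw e ->; left; exists v, w.
- move=> v w w' h t ->; right; left; exists v, w, w'; rewrite del_vertsE.
  by rewrite a_loopE.
- move=> v w w' h b e vw' ww' ->; right; right; left; exists v, w, w'.
  split=> //; first by rewrite a_loopE.
  by split=> //; apply/uniq3P; split=> //; exact: biso_neq b.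
move=> v w v' w' [] b e e' n1 n2 n3 n4 n5 ->; do 3 right; left.
  exists v, w, v', w'; split=> //; apply/uniq4P; split=> //.
  by split=> //; case: b.
(* The isolated b-edge points from [w] to [v] here, so the two ends exchange roles. *)
exists w, v, w', v'; split=> //.
  by apply/uniq4P; split; split=> //; [case: b|exact: nesym].
by rewrite (fsetUC [fset w']) (fsetUC [fset w]).
Qed.

(** * Moves preserve cyclically reduced graphs *)

(** [F] must rematch exactly the surviving vertices whose a-partner is deleted: the second condition
    on [F] says that only these occur in it, the last that all of them do. *)
Lemma a_wfr_cut U F G : a_wfr G ->
  (forall e, e \in F -> exists x y, e = [fset x; y]) ->
  (forall x y, [fset x; y] \in F ->
     [/\ x \in verts G, x \notin U & exists2 u, u \in U & anb G x u]) ->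
  (forall x y z, [fset x; y] \in F -> [fset x; z] \in F -> y = z) ->
  (forall x u, x \notin U -> u \in U -> anb G x u ->
     exists y, [fset x; y] \in F) ->
  a_wfr (cut U F G).
Proof.
move=> [H1 H2 H3 H4] K1 K2 K3 K4; split.
- by move=> e; rewrite /= inE => /orP[/K1//|]; rewrite !inE /= => /andP[/H1].
- move=> x y; rewrite anb_cut vert_cut => /orP[/K2[-> ->]//|].
  by case/and3P=> /H2-> ->.
- move=> x; rewrite vert_cut => /andP[xU /H3[y xy]].
  case yU: (y \in U); last by exists y; rewrite anb_cut xy xU yU orbT.
  by have [z xz] := K4 x y xU yU xy; exists z; rewrite anb_cut xz.
have K x y z : [fset x; y] \in F ->
    ~ [&& anb G x z, x \notin U & z \notin U].
  move=> /K2[_ _ [u uU xu]] /and3P[xz _].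
  by rewrite (H4 _ _ _ xz xu) uU.
move=> x y z; rewrite !anb_cut => /orP[] a /orP[] b.
- exact: K3 a b.
- by case: (K _ _ _ a b).
- by case: (K _ _ _ b a).
by case/and3P: a => a _ _; case/and3P: b => b _ _; exact: H4 a b.
Qed.

(** The set [U] is saturated for b-adjacency, so each b-component is either deleted entirely or left
    intact. *)
Lemma b_wf_cut U F G : b_wf G ->
  (forall x y, x \in U -> badj G x y -> y \in U) ->
  b_wf (cut U F G).
Proof.
move=> [H1 [H2 H2'] H3 H4] sat.
have satC x y : badj G x y -> x \notin U -> y \notin U.
  by move=> xy; apply: contra => yU; apply: sat yU _; rewrite badjC.
split.
- by move=> v w; rewrite bedge_cut !vert_cut => /and3P[/H1[-> ->] -> ->].
- split=> x y z; rewrite !bedge_cut => /and3P[p _ _] /and3P[q _ _].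
    exact: H2 p q.
  exact: H2' p q.
- move=> x; rewrite vert_cut => /andP[xU /H3[y xy]]; exists y.
  have : badj G x y by rewrite /badj; case: xy => ->; rewrite ?orbT.
  by move=> /satC-/(_ xU) yU; rewrite !bedge_cut xU yU; case: xy => ->; auto.
move=> x y; rewrite bedge_cut => /and3P[xy xU yU].
case: (H4 _ _ xy); first by constructor 1.
  by move=> h; constructor 2; exact: b_iso_cut.
move=> [z h]; constructor 3; exists z; apply: b_tri_cut => //.
by apply: (satC y) => //; case: h => _ _ yz _; rewrite /badj yz.
Qed.

(** A lambda21-move is the only one that cuts through a b-component, so saturation fails and the
    edge from [w'] to [w] changes its type. *)
Lemma b_wf_cut_tri v w w' G F : b_wf G -> b_triangle G w v w' ->
  b_wf (cut [fset v] F G).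
Proof.
move=> wG tri.
have [wv vw' ww'] := b_tri_neq tri.
have nv x : (x \notin [fset v]) = (x != v) by rewrite inE.
have [_ bwv bvw' bw'w] := tri.
split.
- by move=> x y; rewrite bedge_cut !vert_cut => /and3P[/(bedge_verts wG)[-> ->] -> ->].
- split=> x y z; rewrite !bedge_cut => /and3P[p _ _] /and3P[q _ _].
    exact: (bedge_fun wG p q).
  exact: (bedge_inj wG p q).
- move=> x; rewrite vert_cut nv => /andP[xv xV].
  have [_ _ /(_ x xV)[y xy] _] := wG.
  have [yv|yv] := eqVneq y v; last first.
    by exists y; rewrite !bedge_cut !nv xv yv; case: xy => ->; auto.
  subst y; have [e|e] : x = w \/ x = w'.
    by apply: (b_tri_badj wG tri); rewrite /badj; case: xy => ->; rewrite ?orbT.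
  - by subst x; exists w'; right; rewrite bedge_cut bw'w !nv xv (eq_sym w') (introN eqP vw').
  - by subst x; exists w; left; rewrite bedge_cut bw'w !nv xv (introN eqP wv).
move=> x y; rewrite bedge_cut => /and3P[xy xU yU].
have [_ _ _ /(_ _ _ xy)[]] := wG; first by constructor 1.
  by move=> h; constructor 2; exact: b_iso_cut.
move=> [z h]; have [zv|zv] := eqVneq z v; last first.
  by constructor 3; exists z; apply: b_tri_cut => //; rewrite nv.
(* A triangle through [v] is the given one, so the edge at hand is the one from [w'] to [w], which
   is now isolated. *)
constructor 2; subst z; have [_ _ yv vx] := h.
have ex := bedge_fun wG vx bvw'; have ey := bedge_inj wG yv bwv.
subst x y; split; first exact: nesym.
  by rewrite bedge_cut xy xU yU.
move=> [p q]; rewrite bedge_cut !nv => /and3P[pq /eqP pv /eqP qv] /=.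
case/or4P=> /eqP ?; subst.
- by rewrite (bedge_fun wG pq xy).
- by case: qv; exact: (bedge_fun wG pq bwv).
- by case: pv; exact: (bedge_inj wG pq bvw').
by rewrite (bedge_inj wG pq xy).
Qed.

(** All deleted vertices collapse onto the survivor [c], and by the first hypothesis a detour
    through [U] can be shortened. One direction serves reductions, the other recovers the
    connectedness of a graph from that of its reduct. *)
Lemma conn_cut U F G c :
  (forall x y u u', x \notin U -> y \notin U -> u \in U -> u' \in U ->
     adjacent G u x -> adjacent G u' y -> x = y \/ adjacent (cut U F G) x y) ->
  c \notin U -> c \in verts G ->
  (forall P, closedp G P -> (forall u, u \in U -> P u <-> P c) /\
     (forall x y, [fset x; y] \in F -> P x <-> P y)) ->
  conn (cut U F G) <-> conn G.
Proof.
move=> K1 cU cV K2.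
have adjE x y : adjacent (cut U F G) x y = ([fset x; y] \in F) ||
    [&& adjacent G x y, x \notin U & y \notin U].
  rewrite !adjacentE anb_cut badj_cut.
  by case: (_ \in F) => //=; case: (x \notin U); case: (y \notin U);
    rewrite ?andbT ?andbF.
have neV (H : graph) x : x \in verts H -> verts H <> fset0.
  by move=> h e; rewrite e inE in h.
split=> -[_ H]; split.
- exact: neV cV.
- move=> P cP x y xV yV Px.
  have [KU KF] := K2 P cP.
  have cP' : closedp (cut U F G) P.
    move=> p q; rewrite adjE => /orP[/KF[]//|/and3P[pq _ _]]; exact: cP pq.
  (* A closed predicate of [G] takes the same value at a deleted vertex and at [c]. *)
  pose rep z := if z \in U then c else z.
  have repV z : z \in verts G -> rep z \in verts (cut U F G).
    by rewrite vert_cut /rep; case: ifP => zU zV; rewrite ?cU ?cV ?zU ?zV.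
  have repP z : P z <-> P (rep z).
    by rewrite /rep; case: ifP => // /KU.
  apply/(repP y)/(H P cP' (rep x) (rep y)); [exact: repV|exact: repV|].
  by have [h _] := repP x; exact: h.
- by apply: (neV _ c); rewrite vert_cut cU.
move=> P cP x y; rewrite !vert_cut => /andP[xU xV] /andP[yU yV] Px.
(* On [U] the value of [Q] is the same everywhere: it holds as soon as one outer neighbour of [U]
   satisfies [P]. The first hypothesis then passes [P] on to every outer neighbour. *)
pose Q z := (z \notin U /\ P z) \/
  (z \in U /\ exists t u, [/\ t \notin U, u \in U, adjacent G u t & P t]).
have cQ : closedp G Q.
  move=> z t zt [[zU Pz]|[zU [t0 [u [t0U uU ut0 Pt0]]]]].
    case tU: (t \in U).
      right; split=> //; exists z, t; split=> //; by rewrite adjacentC.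
    by left; split; [rewrite ?tU|apply: cP Pz; rewrite adjE zt zU tU orbT].
  case tU: (t \in U); first by right; split=> //; exists t0, u.
  left; split; rewrite ?tU //.
  case: (K1 t0 t u z) => //; first by rewrite tU.
    by move=> <-.
  by move=> /cP; apply.
have : Q y by apply: (H Q cQ x y) => //; left.
by case=> -[]; rewrite ?(negbTE yU).
Qed.

Section StepWf.
Variable G : graph.
Hypothesis lG : locwf G.

Let bG : b_wf G. Proof. by case: lG. Qed.

Lemma anb_fun x y z : anb G x y -> anb G x z -> y = z.
Proof. by case: lG => [[_ _ _ H] _]; exact: H. Qed.

Lemma anb_vert x y : anb G x y -> x \in verts G.
Proof. by case: lG => [[_ H _ _] _]; exact: H. Qed.

Lemma anb_vert2 x y : anb G x y -> y \in verts G.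
Proof. by rewrite anbC; exact: anb_vert. Qed.

Lemma anb_ex x : x \in verts G -> exists y, anb G x y.
Proof. by case: lG => [[_ _ H _] _]; exact: H. Qed.

Lemma anb_inj x y z : anb G x z -> anb G y z -> x = y.
Proof. by rewrite (anbC G x) (anbC G y); exact: anb_fun. Qed.

Lemma step_l22 v w w' : anb G v v -> biso G v w -> anb G w w' -> w <> w' ->
  step G [fset v; w; w'] [fset v; w] [fset [fset w']].
Proof.
move=> a b e n; apply: StepL22 => // vw'; subst w'.
by apply: n; exact: anb_inj e a.
Qed.

(** The two missing inequalities of [StepK] follow because a-edges form a matching. The condition
    [w <> v'] excludes an a-edge parallel to the b-edge. *)
Lemma step_k v w v' w' : biso G v w -> anb G v v' -> anb G w w' ->
  v <> v' -> w <> w' -> w <> v' ->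
  step G [fset v; w; v'; w'] [fset v; w] [fset [fset v'; w']].
Proof.
move=> b e e' n1 n2 n3; apply: StepK => //.
  by move=> h; subst w'; apply: n3; rewrite anbC in e'; exact: anb_fun e' e.
by move=> h; subst w'; apply: (biso_neq b); exact: anb_inj e e'.
Qed.

Lemma step_sub S U F : step G S U F ->
  [/\ U `<=` S, S `<=` verts G, exists u, u \in U
    & forall e, e \in F -> e `<=` S].
Proof.
have sub (A B : {fset nat}) : (forall x, x \in A -> x \in B) -> A `<=` B.
  by move=> h; apply/fsubsetP.
case.
- move=> v w h vw e; split.
  + exact: fsubsetUl.
  + by apply: sub => x; rewrite !inE => /orP[]/eqP->;
      [exact: anb_vert e|exact: anb_vert2 e].
  + by exists v; rewrite inE.
  + by move=> f; rewrite inE => /eqP->; exact: fsubsetUr.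
- move=> v w w' a [_ t1 t2 _]; split.
  + by apply: sub => x; rewrite !inE => ->; rewrite orbT.
  + have [h1 h2] := bedge_verts bG t1; have [_ h3] := bedge_verts bG t2.
    by apply: sub => x; rewrite !inE -orbA => /or3P[]/eqP->.
  + by exists v; rewrite inE.
  + by move=> f; rewrite inE.
- move=> v w w' a b e n1 n2; split.
  + exact: fsubsetUl.
  + apply: sub => x; rewrite !inE -orbA => /or3P[]/eqP->;
    [exact: anb_vert a|exact: anb_vert e|exact: anb_vert2 e].
  + by exists v; rewrite !inE eqxx.
  + by move=> f; rewrite inE => /eqP->; exact: fsubsetUr.
move=> v w v' w' b e e' n1 n2 n3 n4 n5; split.
+ by apply: sub => x; rewrite !inE => ->.
+ apply: sub => x; rewrite !inE -!orbA => /or4P[]/eqP->;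
  [exact: anb_vert e|exact: anb_vert e'|exact: anb_vert2 e|exact: anb_vert2 e'].
+ by exists v; rewrite !inE eqxx.
move=> f; rewrite inE => /eqP->.
by apply: sub => x; rewrite !inE => /orP[]->; rewrite ?orbT.
Qed.

Lemma a_wfr_step S U F : step G S U F -> a_wfr (cut U F G).
Proof.
case: lG => aG _.
have two (x y a b : nat) : [fset x; y] \in [fset [fset a; b]] ->
    (x = a /\ y = b) \/ (x = b /\ y = a).
  by rewrite inE => /eqP/fset2_eq.
have one (x y a : nat) : [fset x; y] \in [fset [fset a]] -> x = a /\ y = a.
  by rewrite -(fset1_2 a) => /two[].
case.
- move=> v w h vw e; apply: a_wfr_cut => //.
  + by move=> f; rewrite inE => /eqP->; exists w, w; rewrite fset1_2.
  + move=> x y /one[-> _]; split; first exact: anb_vert2 e.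
      by rewrite inE; apply/eqP/nesym.
    by exists v; rewrite ?inE // anbC.
  + by move=> x y z /one[_ ->] /one[].
  + move=> x u xU; rewrite inE => /eqP->; rewrite anbC => xv.
    by exists w; rewrite (anb_fun xv e) fset1_2 inE.
- move=> v w w' a t; apply: a_wfr_cut => //.
  move=> x u; rewrite !inE => /eqP xv /eqP-> xv'.
  by case: xv; exact: anb_inj xv' a.
- move=> v w w' a b e n1 n2; apply: a_wfr_cut => //.
  + by move=> f; rewrite inE => /eqP->; exists w', w'; rewrite fset1_2.
  + move=> x y /one[-> _]; split; first exact: anb_vert2 e.
      by rewrite !inE negb_or; apply/andP; split; apply/eqP/nesym.
    by exists w; rewrite ?inE ?eqxx ?orbT // anbC.
  + by move=> x y z /one[_ ->] /one[].
  + move=> x u; rewrite !inE negb_or => /andP[/eqP xv /eqP xw] /orP[]/eqP-> h.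
      by case: xv; exact: anb_inj h a.
    rewrite anbC in h.
    by exists w'; rewrite (anb_fun h e) fset1_2 inE.
move=> v w v' w' b e e' n1 n2 n3 n4 n5; apply: a_wfr_cut => //.
+ by move=> f; rewrite inE => /eqP->; exists v', w'.
+ move=> x y /two[][-> _].
    split; first exact: anb_vert2 e.
      by rewrite !inE negb_or; apply/andP; split; apply/eqP/nesym.
    by exists v; rewrite ?inE ?eqxx // anbC.
  split; first exact: anb_vert2 e'.
    by rewrite !inE negb_or; apply/andP; split; apply/eqP/nesym.
  by exists w; rewrite ?inE ?eqxx ?orbT // anbC.
+ by move=> x y z /two[][? ?] /two[][? ?]; subst=> //; case: n5.
move=> x u; rewrite !inE negb_or => /andP[/eqP xv /eqP xw] /orP[]/eqP->;
  rewrite anbC => h.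
  by exists w'; rewrite (anb_fun h e) inE.
by exists v'; rewrite (anb_fun h e') inE fsetUC.
Qed.

Lemma b_wf_step S U F : step G S U F -> b_wf (cut U F G).
Proof.
case.
- move=> v w h _ _; apply: b_wf_cut => // x y /[!inE] /eqP-> vy.
  by rewrite (b_loop_uniq bG h vy).
- by move=> v w w' _ t; exact: b_wf_cut_tri t.
- move=> v w w' _ b _ _ _; apply: b_wf_cut => // x y /[!inE] /orP[]/eqP-> xy.
    by rewrite (biso_uniq b xy) eqxx orbT.
  by move/bisoC: b => b; rewrite (biso_uniq b xy) eqxx.
move=> v w v' w' b *; apply: b_wf_cut => // x y /[!inE] /orP[]/eqP-> xy.
  by rewrite (biso_uniq b xy) eqxx orbT.
by move/bisoC: b => b; rewrite (biso_uniq b xy) eqxx.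
Qed.

(** Stated under local conditions only, so that it applies to an exchanged graph that is not yet
    known to be connected. *)
Lemma conn_step S U F : step G S U F -> conn (cut U F G) <-> conn G.
Proof.
case.
- move=> v w h vw e; apply: (@conn_cut _ _ _ w).
  + have K u x : x \notin [fset v] -> u \in [fset v] -> adjacent G u x -> x = w.
      move=> /[!inE] /eqP xv /eqP->; rewrite adjacentE => /orP[h'|].
        exact: anb_fun h' e.
      by move/(b_loop_uniq bG h).
    by move=> x y u u' xU yU uU uU' /K-> // /K->; auto.
  + by rewrite inE; apply/eqP/nesym.
  + exact: anb_vert2 e.
  move=> P cP; split=> [u /[!inE] /eqP->|x y].
    by apply: (closedpE cP); rewrite adjacentE e.
  by rewrite -(fset1_2 w) inE => /eqP/fset2_eq[][-> ->].
- move=> v w w' a t; have [n1 n2 n3] := b_tri_neq t.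
  have [_ t1 t2 t3] := t.
  (* The third edge of the triangle still joins the two neighbours of [v]. *)
  have adj : adjacent (cut [fset v] fset0 G) w w'.
    rewrite adjacentE badj_cut /badj t3 !inE orbT /= orbC.
    by rewrite (introN eqP n1) (introN eqP (nesym n2)).
  apply: (@conn_cut _ _ _ w).
  + have K u x : x \notin [fset v] -> u \in [fset v] -> adjacent G u x ->
        x = w \/ x = w'.
      move=> /[!inE] /eqP xv /eqP->; rewrite adjacentE => /orP[h'|].
        by case: xv; exact: anb_fun h' a.
      by move/(b_tri_badj bG t).
    move=> x y u u' xU yU uU uU' /K-/(_ xU uU)[]-> /K-/(_ yU uU')[]->; auto.
    by right; rewrite adjacentC.
  + by rewrite inE; apply/eqP.
  + by have [] := bedge_verts bG t1.
  move=> P cP; split=> [u /[!inE] /eqP->|x y /[!inE] //].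
  by apply: (closedpE cP); rewrite adjacentE /badj t1 !orbT.
- move=> v w w' a b e n1 n2; apply: (@conn_cut _ _ _ w').
  + have K u x : x \notin [fset v; w] -> u \in [fset v; w] -> adjacent G u x ->
        x = w'.
      move=> /[!inE]; rewrite negb_or => /andP[/eqP xv /eqP xw] /orP[]/eqP->;
        rewrite adjacentE => /orP[h|h].
      - by case: xv; exact: anb_fun h a.
      - by case: xw; exact: biso_uniq b h.
      - exact: anb_fun h e.
      by case: xv; apply: biso_uniq h; exact/bisoC.
    by move=> x y u u' xU yU uU uU' /K-> // /K->; auto.
  + by rewrite !inE negb_or; apply/andP; split; apply/eqP/nesym.
  + exact: anb_vert2 e.
  move=> P cP; split=> [|x y].
    have E1 : P w <-> P w' by apply: (closedpE cP); rewrite adjacentE e.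
    have E2 : P v <-> P w.
      by apply: (closedpE cP); rewrite adjacentE (biso_badj b) orbT.
    by move=> u /[!inE] /orP[]/eqP->; rewrite ?E2.
  by rewrite -(fset1_2 w') inE => /eqP/fset2_eq[][-> ->].
move=> v w v' w' b e e' n1 n2 n3 n4 n5.
have adj : adjacent (cut [fset v; w] [fset [fset v'; w']] G) v' w'.
  by rewrite adjacentE anb_cut fset11.
apply: (@conn_cut _ _ _ v').
+ have K u x : x \notin [fset v; w] -> u \in [fset v; w] -> adjacent G u x ->
      x = v' \/ x = w'.
    move=> /[!inE]; rewrite negb_or => /andP[/eqP xv /eqP xw] /orP[]/eqP->;
      rewrite adjacentE => /orP[h|h].
    - by left; exact: anb_fun h e.
    - by case: xw; exact: biso_uniq b h.
    - by right; exact: anb_fun h e'.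
    by case: xv; apply: biso_uniq h; exact/bisoC.
  move=> x y u u' xU yU uU uU' /K-/(_ xU uU)[]-> /K-/(_ yU uU')[]->; auto.
  by right; rewrite adjacentC.
+ by rewrite !inE negb_or; apply/andP; split; apply/eqP/nesym.
+ exact: anb_vert2 e.
move=> P cP.
have E1 : P v <-> P v' by apply: (closedpE cP); rewrite adjacentE e.
have E2 : P w <-> P w' by apply: (closedpE cP); rewrite adjacentE e'.
have E3 : P v <-> P w.
  by apply: (closedpE cP); rewrite adjacentE (biso_badj b) orbT.
split=> [u /[!inE] /orP[]/eqP->|x y]; rewrite -?E1 -?E3 //.
by rewrite inE => /eqP/fset2_eq[][-> ->]; rewrite -E1 -E2 E3.
Qed.

Lemma locwf_step S U F : step G S U F -> locwf (cut U F G).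
Proof. by move=> st; split; [exact: a_wfr_step st|exact: b_wf_step st]. Qed.

End StepWf.

Lemma wf_step G S U F : wf G -> step G S U F -> wf (cut U F G).
Proof.
by move=> [cG lG] st; split; [apply/(conn_step lG st)|exact: locwf_step st].
Qed.

Lemma step_card G S U F : locwf G -> step G S U F ->
  (#|` verts (cut U F G)| < #|` verts G|)%N.
Proof.
move=> lG st; have [US SV [u uU] _] := step_sub lG st.
apply: fproper_ltn_card; apply: (@fsub_proper_trans _ (verts G `\ u)).
  by apply: fsetDS; rewrite fsub1set.
by apply: fproperD1; apply: (fsubsetP SV); exact: (fsubsetP US).
Qed.

(** * Critical pairs *)

(** A step asks for the presence of edges within [S] and for the isolation of b-edges. Deletions
    outside [S] keep the former, and no deletion destroys the latter. *)
Lemma step_persist G S U F U' F' : step G S U F ->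
  (forall x, x \in S -> x \notin U') -> step (cut U' F' G) S U F.
Proof.
case.
- move=> v w h vw e H; have hv := H v (fset21 _ _); have hw := H w (fset22 _ _).
  by apply: StepL3 => //; [exact: b_loop_cut|rewrite anb_cut e hv hw orbT].
- move=> v w w' a t H.
  have hv : v \notin U' by apply: H; rewrite !inE eqxx ?orbT.
  have hw : w \notin U' by apply: H; rewrite !inE eqxx ?orbT.
  have hw' : w' \notin U' by apply: H; rewrite !inE eqxx ?orbT.
  by apply: StepL21; [rewrite anb_cut a hv orbT|exact: b_tri_cut].
- move=> v w w' a b e n1 n2 H.
  have hv : v \notin U' by apply: H; rewrite !inE eqxx ?orbT.
  have hw : w \notin U' by apply: H; rewrite !inE eqxx ?orbT.
  have hw' : w' \notin U' by apply: H; rewrite !inE eqxx ?orbT.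
  apply: StepL22 => //; last by rewrite anb_cut e hw hw' orbT.
    by rewrite anb_cut a hv orbT.
  exact: biso_cut.
move=> v w v' w' b e e' n1 n2 n3 n4 n5 H.
have hv : v \notin U' by apply: H; rewrite !inE eqxx ?orbT.
have hw : w \notin U' by apply: H; rewrite !inE eqxx ?orbT.
have hv' : v' \notin U' by apply: H; rewrite !inE eqxx ?orbT.
have hw' : w' \notin U' by apply: H; rewrite !inE eqxx ?orbT.
apply: StepK => //; first exact: biso_cut.
  by rewrite anb_cut e hv hv' orbT.
by rewrite anb_cut e' hw hw' orbT.
Qed.

(** A single step on each side is enough for every critical pair with a common reduct, so uniqueness
    only has to commute one move with a reduction. *)
Definition joinable G1 G2 := exists S3 U3 F3 S4 U4 F4,
  [/\ step G1 S3 U3 F3, step G2 S4 U4 F4 & cut U3 F3 G1 = cut U4 F4 G2].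

(** The third alternative covers results such as two copies of [Delta1] on different vertices, which
    have no common reduct. *)
Definition semijoin G1 G2 := [\/ G1 = G2, joinable G1 G2
  | (#|` verts G1| <= 2)%N /\ (#|` verts G2| <= 2)%N].

Lemma semijoinC G1 G2 : semijoin G1 G2 -> semijoin G2 G1.
Proof.
case=> [->|[S3 [U3 [F3 [S4 [U4 [F4 [? ? e]]]]]]]|[? ?]].
- exact: Or31.
- by apply: Or32; exists S4, U4, F4, S3, U3, F3.
exact: Or33.
Qed.

(** The two moves may share surviving vertices. Since neither deletes what the other inspects, both
    orders give the same total deletion and insertion. *)
Lemma step_join_disjoint G S1 U1 F1 S2 U2 F2 : locwf G ->
  step G S1 U1 F1 -> step G S2 U2 F2 ->
  (forall x, x \in S2 -> x \notin U1) -> (forall x, x \in S1 -> x \notin U2) ->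
  joinable (cut U1 F1 G) (cut U2 F2 G).
Proof.
move=> lG st1 st2 d1 d2; exists S2, U2, F2, S1, U1, F1.
have dis S U F U' (st : step G S U F) : (forall x, x \in S -> x \notin U') ->
    forall e, e \in F -> e `&` U' = fset0.
  move=> d e eF; have [_ _ _ /(_ e eF)/fsubsetP eS] := step_sub lG st.
  apply/fsetP=> x; rewrite !inE; apply/negbTE/negP=> /andP[/eS/d].
  by move/negbTE->.
split; [exact: step_persist|exact: step_persist|].
rewrite (cut_cut_disjoint _ _ _ (dis _ _ _ _ st1 d2)).
rewrite (cut_cut_disjoint _ _ _ (dis _ _ _ _ st2 d1)).
by rewrite fsetUC (fsetUC F2).
Qed.

(** Used to recognise exceptional configurations: once a handful of vertices is closed under
    adjacency, it is the whole graph. *)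
Lemma conn_sub G (T : {fset nat}) x0 : conn G -> x0 \in verts G -> x0 \in T ->
  (forall x y, x \in T -> adjacent G x y -> y \in T) -> verts G `<=` T.
Proof.
move=> [_ H] x0V x0T cT; apply/fsubsetP=> y yV.
by apply: (H (fun z => z \in T) _ x0) => // p q pq pT; exact: cT pT pq.
Qed.

Lemma small_cut G (T U : {fset nat}) F c d : verts G `<=` T ->
  T `<=` U `|` [fset c; d] -> (#|` verts (cut U F G)| <= 2)%N.
Proof.
move=> VT TU; have le2 : (#|` [fset c; d]| <= 2)%N.
  by rewrite cardfs2; case: (_ != _).
apply: leq_trans le2; apply: fsubset_leq_card.
by rewrite /= fsubDset; exact: fsubset_trans TU.
Qed.

Lemma notin1 (x a : nat) : x <> a -> x \notin [fset a].
Proof. by rewrite inE => /eqP. Qed.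

Lemma notin2 (x a b : nat) : x <> a -> x <> b -> x \notin [fset a; b].
Proof. by rewrite !inE negb_or => /eqP-> /eqP->. Qed.

Lemma fset_meet (e U : {fset nat}) x : x \in e -> x \in U -> e `&` U <> fset0.
Proof. by move=> xe xU h; have : x \in e `&` U by [rewrite inE xe|]; rewrite h. Qed.

Section Critical.
Variable G : graph.
Hypothesis wG : wf G.

Let lG : locwf G. Proof. by case: wG. Qed.
Let cG : conn G. Proof. by case: wG. Qed.
Let bG : b_wf G. Proof. by case: lG. Qed.

(** The lambda3-move puts an a-loop at [w], after which a lambda22-move removes [w] and [t]. The
    kappa3-move joins [v] to [t'], after which a lambda3-move removes [v]. Both ways end with an
    a-loop at [t']. *)
Lemma join_l3_k v w t t' : b_loop G v -> v <> w -> anb G v w -> biso G w t ->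
  anb G t t' -> t <> t' ->
  semijoin (cut [fset v] [fset [fset w]] G)
           (cut [fset w; t] [fset [fset v; t']] G).
Proof.
move=> h vw e b e' tt'.
have wt := biso_neq b.
have tv : t <> v by move=> tv; subst t; apply: (@b_loop_not_biso _ bG _ w h); exact/bisoC.
have t'v : t' <> v.
  by move=> ?; subst t'; apply: wt; rewrite anbC in e'; exact: (anb_fun lG e e').
have t'w : t' <> w by move=> ?; subst t'; apply: tv; exact: (anb_inj lG e' e).
apply: Or32; exists [fset w; t; t'], [fset w; t], [fset [fset t']].
exists [fset v; t'], [fset v], [fset [fset t']]; split.
- apply: StepL22.
  + by rewrite anb_cut fset1_2 fset11.
  + by apply: biso_cut => //; apply: notin1; [exact: nesym|].
  + by rewrite anb_cut e' !notin1 ?orbT.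
  + exact: nesym.
  + by [].
- apply: StepL3; [|exact: nesym|by rewrite anb_cut fset11].
  by apply: b_loop_cut => //; apply: notin2 => //; exact: nesym.
rewrite !cut_cut_meet 1?fsetUC // => f /[!inE] /eqP->.
  by apply: (@fset_meet _ _ v); rewrite !inE eqxx ?orbT.
by apply: (@fset_meet _ _ w); rewrite !inE eqxx ?orbT.
Qed.

(** The three vertices are the whole graph; one result is a copy of [Delta3], the other a copy of
    [Delta1]. *)
Lemma join_l3_l22 v w x : b_loop G v -> anb G v w -> anb G x x ->
  biso G x w -> semijoin (cut [fset v] [fset [fset w]] G)
                         (cut [fset x; w] [fset [fset v]] G).
Proof.
move=> h e a b;
have VT : verts G `<=` [fset v; w; x].
  apply: (conn_sub cG (anb_vert lG e)); first by rewrite !inE eqxx.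
  move=> p q; rewrite !inE -!orbA adjacentE => /or3P[]/eqP-> /orP[] k.
  - by rewrite (anb_fun lG k e) eqxx orbT.
  - by rewrite (b_loop_uniq bG h k) eqxx.
  - by rewrite anbC in e; rewrite (anb_fun lG k e) eqxx.
  - by move/bisoC: b => b; rewrite (biso_uniq b k) eqxx !orbT.
  - by rewrite (anb_fun lG k a) eqxx !orbT.
  by rewrite (biso_uniq b k) eqxx orbT.
apply: Or33; split.
  by apply: (small_cut _ VT (c := w) (d := x)); apply/fsubsetP=> p; rewrite !inE -!orbA.
apply: (small_cut _ VT (c := v) (d := v)); apply/fsubsetP=> p; rewrite !inE -!orbA.
by case/or3P=> ->; rewrite ?orbT.
Qed.

(** When [v] and [w] differ, the graph is an a-edge between two b-loops and the results are copies
    of [Delta1] with different labels. *)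
Lemma join_l3_l3 v w : b_loop G v -> anb G v w -> b_loop G w ->
  semijoin (cut [fset v] [fset [fset w]] G) (cut [fset w] [fset [fset v]] G).
Proof.
move=> h e h';
have VT : verts G `<=` [fset v; w].
  apply: (conn_sub cG (anb_vert lG e)); first by rewrite !inE eqxx.
  move=> p q; rewrite !inE adjacentE => /orP[]/eqP-> /orP[] k.
  - by rewrite (anb_fun lG k e) eqxx orbT.
  - by rewrite (b_loop_uniq bG h k) eqxx.
  - by rewrite anbC in e; rewrite (anb_fun lG k e) eqxx.
  by rewrite (b_loop_uniq bG h' k) eqxx !orbT.
by apply: Or33; split; apply: (small_cut _ VT (c := v) (d := w));
  apply/fsubsetP=> p; rewrite !inE => ->; rewrite orbT.
Qed.

Lemma b_iso_cut_tri F v w w' : b_triangle G w v w' ->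
  b_isolated (cut [fset v] F G) w' w.
Proof.
move=> t; have bG1 := b_wf_cut_tri F bG t.
have [n1 n2 n3] := b_tri_neq t; have [_ t1 t2 t3] := t.
have k : (w', w) \in bedges (cut [fset v] F G).
  by rewrite bedge_cut t3 !notin1 //; exact: nesym.
have [_ _ _ /(_ _ _ k)[e|//|[z []]]] := bG1.
  by case: n3.
rewrite !bedge_cut => _ _ /and3P[wz _ zv] _.
by move: zv; rewrite (bedge_fun bG wz t1) inE eqxx.
Qed.

(** If [w'] carries an a-loop too, this is the looped triangle. Otherwise each move leaves an
    isolated b-edge with one a-loop, and a lambda22-move then moves the loop to the a-partner of
    [w']. *)
Lemma join_l21_l21 v w w' : b_triangle G w v w' -> anb G v v -> anb G w w ->
  semijoin (cut [fset v] fset0 G) (cut [fset w] fset0 G).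
Proof.
move=> t a b; have [n1 n2 n3] := b_tri_neq t; have [_ t1 t2 t3] := t.
have w'V := proj2 (bedge_verts bG t2).
have [u' e] := anb_ex lG w'V.
have [uw'|/eqP uw'] := eqVneq u' w'.
  subst u';
  have VT : verts G `<=` [fset v; w; w'].
    apply: (conn_sub cG (anb_vert lG a)); first by rewrite !inE eqxx.
    move=> p q; rewrite !inE -!orbA adjacentE => /or3P[]/eqP-> /orP[] k.
    - by rewrite (anb_fun lG k a) eqxx.
    - by case: (b_tri_badj bG t k) => ->; rewrite eqxx ?orbT.
    - by rewrite (anb_fun lG k b) eqxx orbT.
    - by case: (b_tri_badj bG (b_tri_rot (b_tri_rot t)) k) => ->; rewrite eqxx ?orbT.
    - by rewrite (anb_fun lG k e) eqxx !orbT.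
    by case: (b_tri_badj bG (b_tri_rot t) k) => ->; rewrite eqxx ?orbT.
  apply: Or33; split.
    by apply: (small_cut _ VT (c := w) (d := w')); apply/fsubsetP=> p; rewrite !inE -!orbA.
  apply: (small_cut _ VT (c := v) (d := w')); apply/fsubsetP=> p; rewrite !inE -!orbA.
  by case/or3P=> ->; rewrite ?orbT.
have u'v : u' <> v by move=> ?; subst u'; apply: n2; exact/esym/(anb_inj lG e a).
have u'w : u' <> w by move=> ?; subst u'; apply: n3; exact/esym/(anb_inj lG e b).
apply: Or32; exists [fset w; w'; u'], [fset w; w'], [fset [fset u']].
exists [fset v; w'; u'], [fset v; w'], [fset [fset u']]; split.
- apply: StepL22; [ | |by rewrite anb_cut e !notin1 ?orbT //; exact: nesym|exact: nesym|exact: nesym].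
    by rewrite anb_cut b !notin1 ?orbT.
  by right; exact: b_iso_cut_tri.
- apply: StepL22; [ | |by rewrite anb_cut e !notin1 ?orbT //; exact: nesym|exact: nesym|exact: nesym].
    by rewrite anb_cut a !notin1 ?orbT //; exact: nesym.
  by left; apply: b_iso_cut_tri; exact/b_tri_rot/b_tri_rot.
rewrite !cut_cut_meet //; try by move=> f; rewrite inE.
by rewrite !fsetUA (fsetUC [fset v]).
Qed.

(** The chain [v], [w], [w2], [v2] ends in a-loops on both sides, hence is closed under adjacency,
    and either move keeps at most two of its vertices. *)
Lemma join_l22_l22 v w v2 w2 : anb G v v -> biso G v w -> anb G w w2 ->
  anb G v2 v2 -> biso G v2 w2 ->
  semijoin (cut [fset v; w] [fset [fset w2]] G)
           (cut [fset v2; w2] [fset [fset w]] G).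
Proof.
move=> a b e a2 b2;
have VT : verts G `<=` [fset v; w; v2; w2].
  apply: (conn_sub cG (anb_vert lG a)); first by rewrite !inE eqxx.
  move=> p q; rewrite !inE -!orbA adjacentE => /or4P[]/eqP-> /orP[] k.
  - by rewrite (anb_fun lG k a) eqxx.
  - by rewrite (biso_uniq b k) eqxx orbT.
  - by rewrite (anb_fun lG k e) eqxx !orbT.
  - by move/bisoC: b => b; rewrite (biso_uniq b k) eqxx.
  - by rewrite (anb_fun lG k a2) eqxx !orbT.
  - by rewrite (biso_uniq b2 k) eqxx !orbT.
  - by rewrite anbC in e; rewrite (anb_fun lG k e) eqxx !orbT.
  by move/bisoC: b2 => b2; rewrite (biso_uniq b2 k) eqxx !orbT.
apply: Or33; split.
  by apply: (small_cut _ VT (c := v2) (d := w2)); apply/fsubsetP=> p; rewrite !inE -!orbA.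
apply: (small_cut _ VT (c := v) (d := w)); apply/fsubsetP=> p; rewrite !inE -!orbA.
by case/or4P=> ->; rewrite ?orbT.
Qed.

(** The a-loop at [v] travels along the chain to [y'] whether or not the second b-edge is contracted
    first. *)
Lemma join_l22_k v w x y y' : anb G v v -> biso G v w -> anb G w x -> w <> x ->
  biso G x y -> anb G y y' -> y <> y' -> y <> w ->
  semijoin (cut [fset v; w] [fset [fset x]] G)
           (cut [fset x; y] [fset [fset w; y']] G).
Proof.
move=> a b e wx b' e' yy' yw.
have vw := biso_neq b; have xy := biso_neq b'.
have vx : v <> x by move=> ?; subst x; apply: vw; exact: (anb_inj lG a e).
have vy : v <> y.
  move=> ?; subst y; apply: wx; apply/esym.
  by apply: (biso_uniq b); rewrite badjC; exact: biso_badj.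
have wy' : w <> y'.
  by move=> ?; subst y'; apply: xy; rewrite anbC in e; exact: (anb_inj lG e e').
have vy' : v <> y' by move=> ?; subst y'; apply: vy; exact: (anb_inj lG a e').
have xy' : x <> y' by move=> ?; subst y'; apply: yw; exact: (anb_inj lG e' e).
apply: Or32; exists [fset x; y; y'], [fset x; y], [fset [fset y']].
exists [fset v; w; y'], [fset v; w], [fset [fset y']]; split.
- apply: StepL22 => //; first by rewrite anb_cut fset1_2 fset11.
    by apply: biso_cut => //; apply: notin2 => //; exact: nesym.
  by rewrite anb_cut e' !notin2 ?orbT //; exact: nesym.
- apply: StepL22 => //; last by rewrite anb_cut fset11.
    by rewrite anb_cut a !notin2 ?orbT.
  by apply: biso_cut => //; apply: notin2 => //; exact: nesym.
rewrite !cut_cut_meet 1?fsetUC // => f /[!inE] /eqP->.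
  by apply: (@fset_meet _ _ w); rewrite !inE eqxx ?orbT.
by apply: (@fset_meet _ _ x); rewrite !inE eqxx ?orbT.
Qed.

(** The two b-edges are consecutive along the a-edge from [v] to [v']. Contracting both leaves the
    a-edge from [w'] to [y'], unless they close up to an alternating cycle on four vertices; there
    each move leaves only the other b-edge. *)
Lemma join_k_k v w v' w' y y' : biso G v w -> anb G v v' -> anb G w w' ->
  v <> v' -> w <> w' -> w <> v' -> biso G v' y -> anb G y y' -> y <> y' ->
  semijoin (cut [fset v; w] [fset [fset v'; w']] G)
           (cut [fset v'; y] [fset [fset v; y']] G).
Proof.
move=> b e e' n1 n2 n3 b' e'' n4.
have vw := biso_neq b; have v'y := biso_neq b'.
have yv : y <> v.
  move=> ?; subst y; apply: n3; apply/esym.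
  by apply: (biso_uniq b); rewrite badjC; exact: biso_badj.
have yw : y <> w.
  move=> ?; subst y; apply: n1; move/bisoC: b => b.
  by apply/esym/(biso_uniq b); rewrite badjC; exact: biso_badj.
have [w'y|/eqP w'y] := eqVneq w' y.
  subst w'; rewrite anbC in e'; have ? := anb_fun lG e'' e'; subst y'.
  have VT : verts G `<=` [fset v; w; v'; y].
    apply: (conn_sub cG (anb_vert lG e)); first by rewrite !inE eqxx.
    move=> p q; rewrite !inE -!orbA adjacentE => /or4P[]/eqP-> /orP[] k.
    - by rewrite (anb_fun lG k e) eqxx !orbT.
    - by rewrite (biso_uniq b k) eqxx !orbT.
    - by rewrite anbC in e'; rewrite (anb_fun lG k e') eqxx !orbT.
    - by move/bisoC: b => b; rewrite (biso_uniq b k) eqxx.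
    - by rewrite anbC in e; rewrite (anb_fun lG k e) eqxx.
    - by rewrite (biso_uniq b' k) eqxx !orbT.
    - by rewrite (anb_fun lG k e') eqxx !orbT.
    by move/bisoC: b' => b'; rewrite (biso_uniq b' k) eqxx !orbT.
  apply: Or33; split.
    by apply: (small_cut _ VT (c := v') (d := y)); apply/fsubsetP=> p; rewrite !inE -!orbA.
  apply: (small_cut _ VT (c := v) (d := w)); apply/fsubsetP=> p; rewrite !inE -!orbA.
  by case/or4P=> ->; rewrite ?orbT.
have y'v : y' <> v.
  by move=> ?; subst y'; apply: v'y; rewrite anbC in e''; exact: (anb_fun lG e e'').
have y'w : y' <> w.
  by move=> ?; subst y'; apply: w'y; rewrite anbC in e''; exact: (anb_fun lG e' e'').
have v'w' : v' <> w'.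
  by move=> ?; subst w'; apply: vw; exact: (anb_inj lG e e').
have y'v' : v' <> y'.
  by move=> ?; subst y'; apply: yv; exact: (anb_inj lG e'' e).
have w'y' : w' <> y'.
  by move=> ?; subst y'; apply: yw; exact: (anb_inj lG e'' e').
have vw' : v <> w'.
  move=> ?; subst w'; apply: n3; rewrite anbC in e'; exact/esym/(anb_fun lG e e').
apply: Or32; exists [fset v'; y; w'; y'], [fset v'; y], [fset [fset w'; y']].
exists [fset v; w; y'; w'], [fset v; w], [fset [fset y'; w']]; split.
- apply: StepK => //; last exact: nesym.
  + by apply: biso_cut => //; apply: notin2 => //; exact: nesym.
  + by rewrite anb_cut fset11.
  by rewrite anb_cut e'' !notin2 ?orbT.
- apply: StepK => //; try exact: nesym.
  + by apply: biso_cut => //; apply: notin2 => //; exact: nesym.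
  + by rewrite anb_cut fset11.
  by rewrite anb_cut e' !notin2 ?orbT //; exact: nesym.
rewrite !cut_cut_meet 1?fsetUC 1?(fsetUC [fset y']) // => f /[!inE] /eqP->.
  by apply: (@fset_meet _ _ v); rewrite !inE eqxx ?orbT.
by apply: (@fset_meet _ _ v'); rewrite !inE eqxx ?orbT.
Qed.

End Critical.

(** * Local confluence by the types of the two moves *)

Section LocalConfluence.
Variable G : graph.
Hypothesis wG : wf G.

Let lG : locwf G. Proof. by case: wG. Qed.
Let bG : b_wf G. Proof. by case: lG. Qed.

(** A vertex with a b-loop is on no isolated b-edge and on no triangle, so the second move can only
    meet [v] through its b-loop or through its a-edge to [w]. *)
Lemma join_l3 v w S U F x : b_loop G v -> v <> w -> anb G v w ->
  step G S U F -> x = v -> x \in S ->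
  semijoin (cut [fset v] [fset [fset w]] G) (cut U F G).
Proof.
move=> h vw e [] {S U F}.
- move=> v2 w2 h2 n2 e2 -> /[!inE] /orP[]/eqP ?; subst.
    by rewrite (anb_fun lG e e2); exact: Or31.
  rewrite anbC in e2; have ? := anb_fun lG e e2; subst.
  exact: join_l3_l3.
- move=> v2 w2 w2' a2 t2 -> /[!inE] /orP[/orP[]|] /eqP ?; subst.
  + by case: (b_loop_not_tri bG h t2).
  + by case: vw; exact: (anb_fun lG a2 e).
  + by case: (b_loop_not_tri bG h (b_tri_rot (b_tri_rot t2))).
- move=> v2 w2 w2' a2 b2 e2 n1 n2 -> /[!inE] /orP[/orP[]|] /eqP ?; subst.
  + by case: (b_loop_not_biso bG h b2).
  + by case: (b_loop_not_biso bG h (iffLR (bisoC _ _ _) b2)).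
  + rewrite anbC in e2; have ? := anb_fun lG e e2; subst.
    exact: join_l3_l22.
move=> v2 w2 v2' w2' b2 e2 e2' n1 n2 n3 n4 n5 -> /[!inE] /orP[/orP[/orP[]|]|] /eqP ?; subst.
- by case: (b_loop_not_biso bG h b2).
- by case: (b_loop_not_biso bG h (iffLR (bisoC _ _ _) b2)).
- rewrite anbC in e2; have ? := anb_fun lG e e2; subst.
  exact: join_l3_k.
rewrite anbC in e2'; have ? := anb_fun lG e e2'; subst.
rewrite (fsetUC [fset v2]) (fsetUC [fset v2']).
by apply: join_l3_k => //; exact/bisoC.
Qed.

Lemma join_l21 v w w' S U F : anb G v v -> b_triangle G w v w' ->
  step G S U F -> v \in S ->
  semijoin (cut [fset v] fset0 G) (cut U F G).
Proof.
move=> a t [] {S U F}.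
- move=> v2 w2 h2 n2 e2 /[!inE] /orP[]/eqP ?; subst.
    by case: (b_loop_not_tri bG h2 (b_tri_rot t)).
  by case: n2; exact: (anb_inj lG e2 a).
- move=> v2 w2 w2' a2 t2 /[!inE] /orP[/orP[]|] /eqP ?; subst.
  + have [? ?] := b_tri_uniq bG (b_tri_rot t) t2; subst.
    apply/semijoinC; apply: join_l21_l21 a2 a => //; exact: t2.
  + exact: Or31.
  + have [? ?] := b_tri_uniq bG (b_tri_rot t) (b_tri_rot (b_tri_rot t2)); subst.
    exact: join_l21_l21 t a a2.
- move=> v2 w2 w2' a2 b2 e2 n1 n2 /[!inE] /orP[/orP[]|] /eqP ?; subst.
  + by case: (biso_not_tri b2 (b_tri_rot t)).
  + by case: (biso_not_tri (iffLR (bisoC _ _ _) b2) (b_tri_rot t)).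
  + by case: n2; exact: (anb_inj lG e2 a).
move=> v2 w2 v2' w2' b2 e2 e2' n1 n2 n3 n4 n5 /[!inE] /orP[/orP[/orP[]|]|] /eqP ?; subst.
- by case: (biso_not_tri b2 (b_tri_rot t)).
- by case: (biso_not_tri (iffLR (bisoC _ _ _) b2) (b_tri_rot t)).
- by case: n1; exact: (anb_inj lG e2 a).
by case: n4; exact: (anb_inj lG e2' a).
Qed.

Lemma join_l22 v w w' S U F x : anb G v v -> biso G v w -> anb G w w' ->
  v <> w' -> w <> w' ->
  step G S U F -> x = v \/ x = w -> x \in S ->
  semijoin (cut [fset v; w] [fset [fset w']] G) (cut U F G).
Proof.
move=> a b e n1 n2 [] {S U F}.
- move=> v2 w2 h2 n e2 [] -> /[!inE] /orP[]/eqP ?; subst.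
  + by case: (b_loop_not_biso bG h2 b).
  + by case: n; exact: (anb_inj lG e2 a).
  + by case: (b_loop_not_biso bG h2 (iffLR (bisoC _ _ _) b)).
  + rewrite anbC in e2; have ? := anb_fun lG e e2; subst.
    by apply/semijoinC; rewrite anbC in e2; exact: join_l3_l22.
- move=> v2 w2 w2' a2 t2 [] -> /[!inE] /orP[/orP[]|] /eqP ?; subst.
  + by case: (biso_not_tri b t2).
  + by case: (biso_not_tri b (b_tri_rot t2)).
  + by case: (biso_not_tri b (b_tri_rot (b_tri_rot t2))).
  + by case: (biso_not_tri (iffLR (bisoC _ _ _) b) t2).
  + by case: n2; exact: (anb_fun lG a2 e).
  + by case: (biso_not_tri (iffLR (bisoC _ _ _) b) (b_tri_rot (b_tri_rot t2))).
- move=> v2 w2 w2' a2 b2 e2 n3 n4 H xS.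
  have [?|nv] := pselect (v = v2).
    subst; have ? := biso_uniq b (biso_badj b2); subst.
    by rewrite (anb_fun lG e e2); exact: Or31.
  have vS : v <> w2 /\ v <> w2'.
    by split=> ?; subst; [case: n4; exact: (anb_fun lG a e2)|case: n4; exact: (anb_inj lG e2 a)].
  case: H xS => -> /[!inE] /orP[/orP[]|] /eqP ?; subst; try by case: vS.
  + by case: n2; exact: (anb_fun lG a2 e).
  + move/bisoC: b => b; move/bisoC: b2 => b2.
    by case: nv; exact/esym/(biso_uniq b)/biso_badj.
  + rewrite anbC in e2; have ? := anb_fun lG e e2; subst.
    exact: join_l22_l22.
move=> v2 w2 v2' w2' b2 e2 e2' n3 n4 n5 n6 n7 H xS.
have vS : [/\ v <> v2, v <> w2, v <> v2' & v <> w2'].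
  split=> ?; subst.
  - by apply: n3; exact: (anb_fun lG a e2).
  - by apply: n6; exact: (anb_fun lG a e2').
  - by apply: n3; exact: (anb_inj lG e2 a).
  by apply: n6; exact: (anb_inj lG e2' a).
case: H xS => -> /[!inE] /orP[/orP[/orP[]|]|] /eqP ?; subst; try by case: vS.
- by case: vS => _ + _ _; case; apply: (biso_uniq b2); rewrite badjC; exact: biso_badj.
- move/bisoC: b2 => b2.
  by case: vS => + _ _ _; case; apply: (biso_uniq b2); rewrite badjC; exact: biso_badj.
- rewrite anbC in e2; have ? := anb_fun lG e e2; subst.
  by apply: join_l22_k => //; exact: nesym.
rewrite anbC in e2'; have ? := anb_fun lG e e2'; subst.
rewrite (fsetUC [fset v2]) (fsetUC [fset v2']).
by apply: join_l22_k => //; try exact: nesym; exact/bisoC.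
Qed.

Lemma join_k v w v' w' S U F : biso G v w -> anb G v v' -> anb G w w' ->
  v <> v' -> v <> w' -> w <> v' -> w <> w' -> v' <> w' ->
  step G S U F -> v \in S ->
  semijoin (cut [fset v; w] [fset [fset v'; w']] G) (cut U F G).
Proof.
move=> b e e' n1 n2 n3 n4 n5 [] {S U F}.
- move=> v2 w2 h2 n e2 /[!inE] /orP[]/eqP ?; subst.
    by case: (b_loop_not_biso bG h2 b).
  rewrite anbC in e2; have ? := anb_fun lG e e2; subst.
  by rewrite anbC in e2; apply/semijoinC; exact: join_l3_k.
- move=> v2 w2 w2' a2 t2 /[!inE] /orP[/orP[]|] /eqP ?; subst.
  + by case: (biso_not_tri b t2).
  + by case: (biso_not_tri b (b_tri_rot t2)).
  + by case: (biso_not_tri b (b_tri_rot (b_tri_rot t2))).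
- move=> v2 w2 w2' a2 b2 e2 n6 n7 /[!inE] /orP[/orP[]|] /eqP ?; subst.
  + by case: n1; exact: (anb_fun lG a2 e).
  + move/bisoC: b2 => b2; have ? := biso_uniq b (biso_badj b2); subst.
    by case: n4; exact: (anb_fun lG a2 e').
  + rewrite anbC in e2; have ? := anb_fun lG e e2; subst.
    by rewrite anbC in e2; apply/semijoinC; exact: join_l22_k.
move=> v2 w2 v2' w2' b2 e2 e2' m1 m2 m3 m4 m5 /[!inE] /orP[/orP[/orP[]|]|] /eqP ?; subst.
- have ? := biso_uniq b (biso_badj b2); subst.
  by rewrite (anb_fun lG e e2) (anb_fun lG e' e2'); exact: Or31.
- move/bisoC: b2 => b2; have ? := biso_uniq b (biso_badj b2); subst.
  rewrite (anb_fun lG e e2') (anb_fun lG e' e2).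
  by rewrite (fsetUC [fset w2']) (fsetUC [fset w2]); exact: Or31.
- rewrite anbC in e2; have ? := anb_fun lG e e2; subst.
  by rewrite anbC in e2; apply: join_k_k.
rewrite anbC in e2'; have ? := anb_fun lG e e2'; subst.
rewrite (fsetUC [fset v2]) (fsetUC [fset v2']).
by rewrite anbC in e2'; apply: join_k_k => //; exact/bisoC.
Qed.

(** The overlap is asymmetric: a vertex deleted by the first move is inspected by the second. The
    opposite overlap follows by exchanging the moves. *)
Lemma step_join_meet S1 U1 F1 S2 U2 F2 x :
  step G S1 U1 F1 -> step G S2 U2 F2 -> x \in U1 -> x \in S2 ->
  semijoin (cut U1 F1 G) (cut U2 F2 G).
Proof.
case.
- move=> v w h n e st /[!inE] /eqP xv; exact: join_l3 st xv.
- move=> v w w' a t st /[!inE] /eqP->; exact: join_l21 t st.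
- move=> v w w' a b e n1 n2 st xU; apply: join_l22 st _ => //.
  by move: xU; rewrite !inE => /orP[]/eqP; auto.
move=> v w v' w' b e e' n1 n2 n3 n4 n5 st /[!inE] /orP[]/eqP->.
  exact: join_k.
rewrite (fsetUC [fset v]) (fsetUC [fset v']).
by apply: join_k => //; [exact/bisoC|exact: nesym].
Qed.

Lemma step_join S1 U1 F1 S2 U2 F2 :
  step G S1 U1 F1 -> step G S2 U2 F2 -> semijoin (cut U1 F1 G) (cut U2 F2 G).
Proof.
move=> st1 st2.
have [[x [x1 x2]]|d1] := pselect (exists x, x \in U1 /\ x \in S2).
  exact: step_join_meet st1 st2 x1 x2.
have [[x [x1 x2]]|d2] := pselect (exists x, x \in U2 /\ x \in S1).
  by apply/semijoinC; exact: step_join_meet st2 st1 x1 x2.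
apply: Or32; apply: step_join_disjoint lG st1 st2 _ _ => x xS; apply/negP => xU.
  by apply: d1; exists x.
by apply: d2; exists x.
Qed.

End LocalConfluence.

(** * Normal forms *)

Lemma b_wf_iso_or G x y : b_wf G -> (x, y) \in bedges G ->
  [\/ x = y, b_isolated G x y | exists u, b_triangle G x y u].
Proof. by case=> _ _ _; exact. Qed.

Lemma b_ex G x : b_wf G -> x \in verts G -> exists y, badj G x y.
Proof.
move=> [_ _ H _] /H[y xy]; exists y; rewrite /badj.
by case: xy => ->; rewrite ?orbT.
Qed.

Lemma vert_neq0 G x : x \in verts G -> verts G <> fset0.
Proof. by move=> h e; rewrite e inE in h. Qed.

Lemma wf_Delta1 v : wf (Delta1 v).
Proof.
have bE x y : ((x, y) \in bedges (Delta1 v)) = (x == v) && (y == v).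
  by rewrite /= inE xpair_eqE.
have aE x y : anb (Delta1 v) x y -> x = v /\ y = v.
  by rewrite /anb /= -(fset1_2 v) inE => /eqP/fset2_eq[].
have lv : anb (Delta1 v) v v by rewrite /anb /= fset1_2 inE.
split; last split; first split.
- exact: (@vert_neq0 (Delta1 v) v (fset11 v)).
- by move=> P _ x y /[!inE] /eqP-> /eqP->.
- split.
  + by move=> e /[!inE] /eqP->; exists v, v; rewrite fset1_2.
  + by move=> x y /aE[-> _]; rewrite inE.
  + by move=> x /[!inE] /eqP->; exists v.
  + by move=> x y z /aE[_ ->] /aE[].
split.
- by move=> x y; rewrite bE => /andP[/eqP-> /eqP->]; rewrite inE.
- by split=> x y z; rewrite !bE => /andP[/eqP ? /eqP ?] /andP[/eqP ? /eqP ?]; subst.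
- by move=> x /[!inE] /eqP->; exists v; left; rewrite bE eqxx.
by move=> x y; rewrite bE => /andP[/eqP-> /eqP->]; constructor 1.
Qed.

Lemma move_wf G G' : wf G -> move G G' -> wf G'.
Proof.
move=> wG /moveP[[S [U [F [st ->]]]]|[v [w [_ _ ->]]]]; last exact: wf_Delta1.
exact: wf_step st.
Qed.

Lemma move_sub G G' : move G G' -> verts G' `<=` verts G.
Proof.
case/moveP=> [[S [U [F [st ->]]]]|[v [w [_ -> ->]]]]; first exact: fsubsetDl.
exact: fsubsetUl.
Qed.

Lemma move_card G G' : wf G -> move G G' -> (#|` verts G'| < #|` verts G|)%N.
Proof.
move=> [_ lG] /moveP[[S [U [F [st ->]]]]|[v [w [vw -> ->]]]].
  exact: step_card st.
by rewrite /= cardfs1 cardfs2 (introN eqP vw).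
Qed.

Lemma reduces_inv G D :
  reduces G D -> G = D \/ exists G1, move G G1 /\ reduces G1 D.
Proof. by case=> [|G1 {}D m r]; [left|right; exists G1]. Qed.

Lemma reduces_wf G D : wf G -> reduces G D -> wf D.
Proof. by move=> + r; elim: r => {G D} // G G' D m _ IH /move_wf-/(_ _ m)/IH. Qed.

Lemma reduces_sub G D : reduces G D -> verts D `<=` verts G.
Proof.
elim=> {G D} // G G' D m _ IH; exact: fsubset_trans IH (move_sub m).
Qed.

Lemma reduces_card G D : reduces G D -> (#|` verts D| <= #|` verts G|)%N.
Proof. by move/reduces_sub/fsubset_leq_card. Qed.

Lemma reduces_card_eq G D : wf G -> reduces G D ->
  #|` verts D| = #|` verts G| -> D = G.
Proof.
move=> wG [//|G' {}D m /reduces_card c e].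
by have := move_card wG m; rewrite -e ltnNge c.
Qed.

Definition terminal D := forall D', ~ move D D'.

Lemma terminal_reduces D E : terminal D -> reduces D E -> D = E.
Proof. by move=> t [//|G {}E m _]; case: (t G). Qed.

Lemma terminal_ex G : wf G -> exists D, reduces G D /\ terminal D.
Proof.
have [n] := ubnP #|` verts G|; elim: n G => // n IH G c wG.
have [[G' m]|t] := pselect (exists G', move G G').
  have [|D [r t]] := IH G' _ (move_wf wG m).
    by apply: leq_trans (move_card wG m) _; rewrite -ltnS.
  by exists D; split=> //; apply: rt1n_trans m r.
by exists G; split; [exact: rt1n_refl|move=> D m; apply: t; exists D].
Qed.

Lemma step_move G S U F : step G S U F -> move G (cut U F G).
Proof. by move=> st; apply/moveP; left; exists S, U, F. Qed.

(** A Newman-style induction on the number of vertices: a reduction to [D] can be made to start with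
    any available move. Vertex sets only shrink, so the size of [D] rules out [exc] and the small
    alternative of [semijoin]. *)
Lemma reduces_move G G' D : wf G -> reduces G D -> terminal D ->
  (2 < #|` verts D|)%N -> move G G' -> reduces G' D.
Proof.
move=> + + tD cD.
have [n] := ubnP #|` verts G|; elim: n G G' => // n IH G G' c wG r m.
have cG := reduces_card r.
have [e|[G1 [m1 r1]]] := reduces_inv r; first by subst G; case: (tD _ m).
have nexc H : ~ exc G H.
  move=> [v [w [_ e _]]]; have := leq_trans cD cG.
  by rewrite e /= cardfs2; case: (_ != _).
case/moveP: (m1) => [[S1 [U1 [F1 [st1 e1]]]]|/nexc//].
case/moveP: m => [[S2 [U2 [F2 [st2 e2]]]]|/nexc//].
case: (step_join wG st1 st2); rewrite -e1 -e2.
- by move=> <-.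
- move=> [S3 [U3 [F3 [S4 [U4 [F4 [st3 st4 e]]]]]]].
  apply: rt1n_trans (step_move st4) _; rewrite -e.
  apply: (IH G1) => //; last exact: step_move st3.
    by apply: leq_trans (move_card wG m1) _; rewrite -ltnS.
  exact: move_wf wG m1.
by case=> + _; rewrite leqNgt (leq_trans cD (reduces_card r1)).
Qed.

Lemma terminal_uniq G D D' : wf G -> reduces G D -> terminal D ->
  (2 < #|` verts D|)%N -> reduces G D' -> terminal D' -> D = D'.
Proof.
move=> + + tD cD r'; elim: r' => {G D'} [G|G G' D' m r' IH] wG r tD'.
  by apply/esym/terminal_reduces.
by apply: IH => //; [exact: move_wf m|exact: reduces_move m].
Qed.

(** * The two labeling conventions and the existence of quasi-silhouettes *)

Definition all_isolated G := (forall x, ~ anb G x x) /\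
  (forall x y, (x, y) \in bedges G -> b_isolated G x y).

(** Any prescribed b-edge can be spared by contracting the others one at a time; the convention for
    alternating cycles then spares the one with maximal start. *)
Lemma all_isolated_reduces G e : wf G -> all_isolated G -> e \in bedges G ->
  exists D, [/\ reduces G D, terminal D & bedges D = [fset e]].
Proof.
have [n] := ubnP #|` verts G|; elim: n G => // n IH G c wG [na bi] eG.
have [cG lG] := wG; have [aG bG] := lG.
have [[[v w] [fG /= fe]]|B1] := pselect (exists f, f \in bedges G /\ f <> e).
  have b := bi _ _ fG; have [vw _ biU] := b.
  have [vV wV] := bedge_verts bG fG.
  have [v' e1] := anb_ex lG vV; have [w' e2] := anb_ex lG wV.
  have n1 : v <> v' by move=> ?; subst v'; exact: na e1.
  have n2 : w <> w' by move=> ?; subst w'; exact: na e2.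
  have eout : [/\ e.1 <> v, e.1 <> w, e.2 <> v & e.2 <> w].
    by split=> h; apply: fe; apply/esym/biU => //; rewrite h eqxx ?orbT.
  (* An a-edge parallel to this b-edge would make [v] and [w] the whole graph and leave no room for
     [e]. *)
  have n3 : w <> v'.
    move=> ?; subst v'.
    have VT : verts G `<=` [fset v; w].
      apply: (conn_sub cG vV); first by rewrite !inE eqxx.
      move=> p q; rewrite !inE adjacentE => /orP[]/eqP-> /orP[] k.
      - by rewrite (anb_fun lG k e1) eqxx orbT.
      - by rewrite (biso_uniq (or_introl b) k) eqxx orbT.
      - by rewrite anbC in e1; rewrite (anb_fun lG k e1) eqxx.
      by rewrite (biso_uniq (or_intror b) k) eqxx.
    move: eG; rewrite (surjective_pairing e) => /(bedge_verts bG)[+ _].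
    by move/(fsubsetP VT); case: eout => h1 h2 _ _; rewrite !inE => /orP[]/eqP.
  have st := step_k lG (or_introl b) e1 e2 n1 n2 n3.
  have [|||D [r t bD]] := IH _ _ (wf_step wG st).
  - by apply: leq_trans (step_card lG st) _; rewrite -ltnS.
  - split=> [x|x y].
      rewrite anb_cut => /orP[|/and3P[/na//]].
      rewrite inE => /eqP/fset2_eq [] [? ?]; subst.
        by apply: vw; exact: (anb_inj lG e1 e2).
      by apply: vw; exact: (anb_inj lG e1 e2).
    by rewrite bedge_cut => /and3P[/bi h xU yU]; exact: b_iso_cut.
  - case: eout => *; rewrite (surjective_pairing e) bedge_cut.
    by rewrite -surjective_pairing eG !notin2.
  by exists D; split=> //; apply: rt1n_trans (step_move st) r.
have BE : bedges G = [fset e].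
  apply/fsetP=> f; rewrite inE; apply/idP/eqP => [fG|-> //].
  by apply: contrapT => h; apply: B1; exists f.
exists G; split=> //; first exact: rt1n_refl.
move=> G' /moveP[[S [U [F [st _]]]]|[v [w [_ h _]]]]; last first.
  by apply: (na v); rewrite h /anb /= fset1_2 !inE eqxx.
case: st.
- by move=> v w /bi[].
- by move=> v w w' /na.
- by move=> v w w' /na.
move=> v w v' w' b e1 e2 n1 n2 n3 n4 n5.
(* With a single b-edge left, the outer vertex [v'] of a kappa3-move would lie on no b-edge. *)
have [y v'y] := b_ex bG (anb_vert2 lG e1).
have := biso_badj b; rewrite /badj BE !inE => /orP[]/eqP ?; subst e;
by move: v'y; rewrite /badj BE !inE !xpair_eqE => /orP[]/andP[/eqP ? /eqP ?]; subst.
Qed.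

Lemma flatten_pairs_neq (c : seq (nat * nat)) p q :
  uniq (flatten [seq [:: p.1; p.2] | p <- c]) -> p \in c -> q \in c ->
  p.2 <> q.1.
Proof.
have M (d : seq (nat * nat)) r : r \in d ->
    r.1 \in flatten [seq [:: p.1; p.2] | p <- d] /\
    r.2 \in flatten [seq [:: p.1; p.2] | p <- d].
  by move=> rd; split; apply/flatten_mapP; exists r; rewrite ?inE ?eqxx ?orbT.
elim: c => //= r c IH; rewrite inE negb_or.
case/and3P=> /andP[/eqP n1 n2] n3 u; rewrite !inE.
case/orP=> [/eqP->|pc] /orP[/eqP->|qc] //.
- exact: nesym.
- by move=> h; move: n3; rewrite h (proj1 (M _ _ qc)).
- by move=> h; move: n2; rewrite -h (proj2 (M _ _ pc)).
exact: IH.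
Qed.

(** An a-loop would identify the exit of one b-edge of the cycle with the entrance of another,
    although all listed vertices are distinct. *)
Lemma alternating_all_isolated G : wf G -> alternating_cycle G ->
  all_isolated G.
Proof.
move=> [_ lG] [c [_ u V bi cy]]; have [aG bG] := lG; split.
  move=> x xx; have := anb_vert lG xx; rewrite V => /flatten_mapP[p pc].
  rewrite !inE => /orP[]/eqP ?; subst x.
    have e := prev_cycle cy pc; rewrite -mem_prev in pc.
    by apply: (flatten_pairs_neq u pc); rewrite ?mem_prev in pc *;
      [exact: pc|exact: (anb_inj lG e xx)].
  have e := next_cycle cy pc.
  apply: (flatten_pairs_neq u pc (q := next c p)); first by rewrite mem_next.
  exact: (anb_fun lG xx e).
move=> x y xy; have := proj1 (bedge_verts bG xy).
rewrite V => /flatten_mapP[p /bi b]; rewrite !inE => xp.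
have e a b' : b_isolated G a b' -> (x == a) || (x == b') -> b_isolated G x y.
  move=> iso xab; have [_ _ H] := iso; have := H _ xy.
  by case/orP: xab => -> /=; rewrite ?orbT => /(_ isT) [-> ->].
by case: b => b; apply: e b _; rewrite // orbC.
Qed.

Lemma seq_max_start (s : seq (nat * nat)) : s <> [::] ->
  exists2 e, e \in s & forall f, f \in s -> (f.1 <= e.1)%N.
Proof.
elim: s => // a [|b s] IH _.
  by exists a; rewrite ?inE // => f; rewrite inE => /eqP->.
have [//|e es H] := IH; have [ae|ea] := leqP a.1 e.1.
  by exists e => [|f]; rewrite inE ?es ?orbT // => /orP[/eqP->|/H].
exists a => [|f]; rewrite inE ?eqxx // => /orP[/eqP->//|/H fe].
exact: leq_trans fe (ltnW ea).
Qed.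

Lemma max_start_ex G : wf G -> exists e, max_start G e.
Proof.
move=> [[/eqP/fset0Pn[x xV] _] [_ bG]]; have [y xy] := b_ex bG xV.
have [|e eB H] := @seq_max_start (bedges G); last by exists e.
by case/orP: xy => h e; rewrite -[_ \in _]/(_ \in (bedges G : seq _)) e in h.
Qed.

(** The vertex to delete is the one opposite the b-edge with maximal start; the three cases are
    rotations of the triangle. *)
Lemma looped_triangle_lambda21 G : wf G -> looped_triangle G ->
  exists e G1, [/\ max_start G e, lambda21 G G1 & bedges G1 = [fset e]].
Proof.
move=> wG [u [v [w [V t [au av aw]]]]].
have [_ [_ bG]] := wG; have [[x y] [eB emax]] := max_start_ex wG.
suff [z [t' az V']] : exists z, [/\ b_triangle G x y z, a_loop G z
    & forall p, p \in verts G -> [\/ p = x, p = y | p = z]].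
  exists (x, y), (del_verts [fset z] G); split=> //.
    by exists z, y, x; split=> //; exact/b_tri_rot.
  have [n1 n2 n3] := b_tri_neq t'; have [_ t1 t2 t3] := t'.
  rewrite del_vertsE; apply/fsetP=> f; rewrite in_fset1.
  apply/idP/eqP => [|->]; rewrite ?bedge_cut; last first.
    by rewrite eB !notin1.
  case: f => p q; rewrite bedge_cut => /and3P[pq pz qz].
  case: (V' _ (proj1 (bedge_verts bG pq))) => e; subst p.
  - by rewrite (bedge_fun bG pq t1).
  - by rewrite (bedge_fun bG pq t2) inE eqxx in qz.
  by rewrite inE eqxx in pz.
have [_ t1 t2 t3] := t.
have V' p : p \in verts G -> [\/ p = u, p = v | p = w].
  by rewrite V !inE -orbA => /or3P[]/eqP; [constructor 1|constructor 2|constructor 3].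
case: (V' _ (proj1 (bedge_verts bG eB))) => e; subst x.
- exists w; rewrite (bedge_fun bG eB t1); split=> //.
- exists u; rewrite (bedge_fun bG eB t2); split=> //; first exact: b_tri_rot.
  by move=> p /V'[]; [constructor 3|constructor 1|constructor 2].
exists v; rewrite (bedge_fun bG eB t3); split=> //; first exact/b_tri_rot/b_tri_rot.
by move=> p /V'[]; [constructor 2|constructor 3|constructor 1].
Qed.

(** The conventions never compete: a looped triangle has a-loops, an alternating cycle has none. So
    some result obeys whichever convention applies, and [xget] does not fall back on its default. *)
Lemma qsilhP G : wf G -> is_qsilh G (qsilh G).
Proof.
move=> wG; suff [D GD] : exists D, is_qsilh G D by exact: (@xgetPex _ G (is_qsilh G) (ex_intro _ D GD)).
have [lt|nlt] := pselect (looped_triangle G).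
  have [e [G1 [me m be]]] := looped_triangle_lambda21 wG lt.
  have mv : move G G1 by right; left.
  have [D [r t]] := terminal_ex (move_wf wG mv).
  exists D; split=> //; first exact: rt1n_trans mv r.
    by move=> _; exists e, G1.
  move=> /(alternating_all_isolated wG)[na _].
  by have [u [v [w [_ _ [/[!a_loopE] /na]]]]] := lt.
have [ac|nac] := pselect (alternating_cycle G).
  have [e me] := max_start_ex wG.
  have [D [r t b]] := all_isolated_reduces wG (alternating_all_isolated wG ac) (proj1 me).
  by exists D; split=> // _; exists e.
by have [D [r t]] := terminal_ex wG; exists D; split.
Qed.

Lemma qsilh_reduces G : wf G -> reduces G (qsilh G).
Proof. by move/qsilhP=> []. Qed.

Lemma qsilh_terminal G : wf G -> terminal (qsilh G).
Proof. by move/qsilhP=> []. Qed.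

Lemma qsilh_wf G : wf G -> wf (qsilh G).
Proof. by move=> wG; exact: reduces_wf (qsilh_reduces wG). Qed.

Lemma qsilh_id D : wf D -> terminal D -> qsilh D = D.
Proof.
by move=> wD tD; apply/esym/(terminal_reduces tD); exact: qsilh_reduces.
Qed.

Lemma qsilh_uniq G D : wf G -> reduces G D -> terminal D ->
  (2 < #|` verts D|)%N -> qsilh G = D.
Proof.
move=> wG r t c; apply/esym/(terminal_uniq wG r t c).
  exact: qsilh_reduces.
exact: qsilh_terminal.
Qed.

(** * Relabeling *)

Definition img (g : nat -> nat) (e : {fset nat}) : {fset nat} :=
  [fset g v | v in e].

Section Img.
Variable g : nat -> nat.
Hypothesis gI : injective g.

Lemma img_fset2 x y : img g [fset x; y] = [fset g x; g y].
Proof. exact: imfset_fset2. Qed.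

Lemma img_fset1 x : img g [fset x] = [fset g x].
Proof. exact: imfset_fset1. Qed.

Lemma mem_img x (e : {fset nat}) : (g x \in img g e) = (x \in e).
Proof. by rewrite /img mem_imfset. Qed.

Lemma imgP (e : {fset nat}) y : y \in img g e -> exists2 x, y = g x & x \in e.
Proof. by move=> /imfsetP[x /= xe ->]; exists x. Qed.

Lemma img_inj : injective (img g).
Proof.
move=> e f /fsetP h; apply/fsetP=> x; have := h (g x).
by rewrite !mem_img.
Qed.

Lemma img_disjoint e U : (img g e `&` img g U == fset0) = (e `&` U == fset0).
Proof.
apply/eqP/eqP => /fsetP h; apply/fsetP=> x.
  by have := h (g x); rewrite !inE !mem_img.
rewrite !inE; apply/negbTE/negP=> /andP[/imgP[y -> ye]].
by rewrite mem_img => yU; have := h y; rewrite !inE ye yU.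
Qed.

End Img.

Lemma img_fset2_inv g (e : {fset nat}) X Y : [fset X; Y] = img g e ->
  exists x y, [/\ X = g x, Y = g y, x \in e & y \in e].
Proof.
move=> h; have := fset21 X Y; rewrite h => /imgP[x -> xe].
by have := fset22 X Y; rewrite h => /imgP[y -> ye]; exists x, y.
Qed.

Section Relabel.
Variable g : nat -> nat.
Hypothesis gI : injective g.
Variable G : graph.

Lemma vert_relabel x : (g x \in verts (relabel g G)) = (x \in verts G).
Proof. exact: mem_img. Qed.

Lemma anb_relabel x y : anb (relabel g G) (g x) (g y) = anb G x y.
Proof.
rewrite /anb -img_fset2 /= (mem_imfset _ _ (f := img g)) //.
exact: img_inj.
Qed.

Lemma bedge_relabel x y :
  ((g x, g y) \in bedges (relabel g G)) = ((x, y) \in bedges G).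
Proof.
have I : injective (fun e : nat * nat => (g e.1, g e.2)).
  by move=> [a b] [c d] /= [/gI-> /gI->].
exact: (mem_imfset _ _ I (x, y)).
Qed.

Lemma anb_relabelP X Y : anb (relabel g G) X Y ->
  exists x y, [/\ X = g x, Y = g y & anb G x y].
Proof.
move=> h; have /imfsetP[e /= eG /img_fset2_inv[x [y [eX eY _ _]]]] := h.
by exists x, y; split=> //; rewrite eX eY anb_relabel in h.
Qed.

Lemma bedge_relabelP X Y : (X, Y) \in bedges (relabel g G) ->
  exists x y, [/\ X = g x, Y = g y & (x, y) \in bedges G].
Proof. by move=> /imfsetP[[x y] /= xy [-> ->]]; exists x, y. Qed.

Lemma b_loop_relabel x : b_loop G x -> b_loop (relabel g G) (g x).
Proof. by rewrite /b_loop bedge_relabel. Qed.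

Lemma b_iso_relabel x y :
  b_isolated G x y -> b_isolated (relabel g G) (g x) (g y).
Proof.
case=> xy b H; split; first by move/gI.
  by rewrite bedge_relabel.
move=> [X Y] /bedge_relabelP[p [q [-> -> /H]]] /=; rewrite !(inj_eq gI).
by move=> h /h[-> ->].
Qed.

Lemma biso_relabel x y : biso G x y -> biso (relabel g G) (g x) (g y).
Proof. by case=> h; [left|right]; exact: b_iso_relabel. Qed.

Lemma b_tri_relabel x y z :
  b_triangle G x y z -> b_triangle (relabel g G) (g x) (g y) (g z).
Proof.
case=> u xy yz zx; split; rewrite ?bedge_relabel //.
by rewrite -(map_inj_uniq gI) in u.
Qed.

Lemma relabel_cut U F : relabel g (cut U F G) =
  cut (img g U) [fset img g e | e in F] (relabel g G).
Proof.
congr Graph => /=.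
- apply/fsetP=> y; rewrite inE; apply/idP/idP.
    by move=> /imgP[x -> ]; rewrite !inE !mem_img.
  case/andP=> yU /imgP[x e xG]; subst y; rewrite mem_img //.
  by rewrite mem_img // in yU; rewrite !inE yU.
- rewrite imfsetU; congr (_ `|` _); apply/fsetP=> e; rewrite !inE /=.
  apply/idP/idP.
    move=> /imfsetP[f /=]; rewrite !inE /= => /andP[fG fU] ->.
    by rewrite -/(img g f) img_disjoint // fU andbT; apply/imfsetP; exists f.
  case/andP=> /imfsetP[f /= fG ->] fU; apply/imfsetP; exists f => //=.
  by rewrite !inE /= fG; rewrite -/(img g f) img_disjoint in fU.
apply/fsetP=> e; rewrite !inE /=; apply/idP/idP.
  move=> /imfsetP[f /=]; rewrite !inE /= => /andP[fG fU] ->.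
  by rewrite /= !mem_img // fU andbT; apply/imfsetP; exists f.
case/andP=> /imfsetP[f /= fG ->] /=; rewrite !mem_img // => fU.
by apply/imfsetP; exists f => //=; rewrite !inE /= fG.
Qed.

Lemma step_relabel S U F : step G S U F ->
  step (relabel g G) (img g S) (img g U) [fset img g e | e in F].
Proof.
have N x y : x <> y -> g x <> g y by move=> n /gI.
case.
- move=> v w h n e; rewrite imfset_fset1 img_fset2 !img_fset1.
  by apply: StepL3; rewrite ?anb_relabel //; [exact: b_loop_relabel|exact: N].
- move=> v w w' a t; rewrite imfset0 {1}/img imfsetU -!/(img _ _) img_fset2 !img_fset1.
  by apply: StepL21; rewrite ?anb_relabel //; exact: b_tri_relabel.
- move=> v w w' a b e n1 n2.
  rewrite imfset_fset1 {1}/img imfsetU -!/(img _ _) !img_fset2 !img_fset1.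
  by apply: StepL22; rewrite ?anb_relabel //; [exact: biso_relabel|exact: N|exact: N].
move=> v w v' w' b e e' n1 n2 n3 n4 n5.
rewrite imfset_fset1 {1}/img !imfsetU -!/(img _ _) !img_fset2 !img_fset1.
by apply: StepK; rewrite ?anb_relabel //; [exact: biso_relabel|exact: N..].
Qed.

End Relabel.

Lemma relabel_Delta1 g v : relabel g (Delta1 v) = Delta1 (g v).
Proof.
by congr Graph; rewrite /= !imfset_fset1 ?img_fset1.
Qed.

Lemma relabel_Delta3 g v w : relabel g (Delta3 v w) = Delta3 (g v) (g w).
Proof.
by congr Graph; rewrite /= ?imfset_fset2 ?imfset_fset1 ?imfset_fset1.
Qed.

Lemma move_relabel g G G' : injective g -> move G G' ->
  move (relabel g G) (relabel g G').
Proof.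
move=> gI /moveP[[S [U [F [st ->]]]]|[v [w [vw -> ->]]]]; apply/moveP.
  left; exists (img g S), (img g U), [fset img g e | e in F].
  by rewrite relabel_cut //; split=> //; exact: step_relabel.
by right; exists (g v), (g w); rewrite relabel_Delta1 relabel_Delta3; split=> // /gI.
Qed.

Lemma reduces_relabel g G D : injective g -> reduces G D ->
  reduces (relabel g G) (relabel g D).
Proof.
move=> gI; elim=> {G D} [G|G G' D m _ r]; first exact: rt1n_refl.
by apply: rt1n_trans r; exact: move_relabel.
Qed.

Lemma wf_relabel g G : injective g -> wf G -> wf (relabel g G).
Proof.
move=> gI [[ne H] [[A1 A2 A3 A4] [B1 [B2 B3] B4 B5]]].
split; last split; first split.
- have /eqP/fset0Pn[x xG] := ne.
  by apply: (@vert_neq0 _ (g x)); rewrite vert_relabel.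
- move=> P cP X Y /imgP[x -> xG] /imgP[y -> yG].
  apply: (H (P \o g)) => // p q pq; apply: cP; move: pq.
  by rewrite !adjacentE anb_relabel // /badj !bedge_relabel.
- split.
  + move=> e /imfsetP[f /= fG ->]; have [x [y ->]] := A1 f fG.
    by exists (g x), (g y); exact: img_fset2.
  + by move=> X Y /anb_relabelP[//|x [y [-> _ /A2]]]; rewrite vert_relabel.
  + move=> X /imgP[x -> /A3[y xy]]; exists (g y).
    by rewrite anb_relabel.
  + move=> X Y Z /anb_relabelP[//|x [y [-> -> xy]]] /anb_relabelP[//|x' [z [/gI<- -> xz]]].
    by rewrite (A4 _ _ _ xy xz).
split.
- move=> X Y /bedge_relabelP[x [y [-> -> /B1]]].
  by rewrite !vert_relabel.
- split.
    move=> X Y Z /bedge_relabelP[x [y [-> -> xy]]] /bedge_relabelP[x' [z [/gI<- -> xz]]].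
    by rewrite (B2 _ _ _ xy xz).
  move=> X Y Z /bedge_relabelP[x [y [-> -> xy]]] /bedge_relabelP[x' [z [-> /gI<- xz]]].
  by rewrite (B3 _ _ _ xy xz).
- move=> X /imgP[x -> /B4[y xy]]; exists (g y).
  by rewrite !bedge_relabel.
move=> X Y /bedge_relabelP[x [y [-> -> /B5[]]]].
- by move=> ->; constructor 1.
- by move=> h; constructor 2; exact: b_iso_relabel.
by move=> [z h]; constructor 3; exists (g z); exact: b_tri_relabel.
Qed.

Lemma relabel_comp f g G : relabel f (relabel g G) = relabel (f \o g) G.
Proof.
congr Graph; apply/fsetP=> e; apply/imfsetP/imfsetP => /=.
- by move=> [x /imgP[y -> yG] ->]; exists y.
- by move=> [y yG ->]; exists (g y) => //; apply/imfsetP; exists y.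
- move=> [x /imfsetP[y /= yG ->] ->]; exists y => //.
  apply/fsetP=> z; apply/imfsetP/imfsetP => /=.
    by move=> [t /imgP[u -> uy] ->]; exists u.
  by move=> [u uy ->]; exists (g u) => //; apply/imfsetP; exists u.
- move=> [y yG ->]; exists (img g y); first by apply/imfsetP; exists y.
  apply/fsetP=> z; apply/imfsetP/imfsetP => /=.
    by move=> [u uy ->]; exists (g u) => //; apply/imfsetP; exists u.
  by move=> [t /imgP[u -> uy] ->]; exists u.
- by move=> [x /imfsetP[y /= yG ->] ->]; exists y.
by move=> [y yG ->]; exists (g y.1, g y.2) => //; apply/imfsetP; exists y.
Qed.

Lemma relabel_eq f g G : wf G -> {in verts G, f =1 g} ->
  relabel f G = relabel g G.
Proof.
move=> [_ lG] fg; have [aG bG] := lG; congr Graph.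
- exact: eq_in_imfset.
- apply: eq_in_imfset => // e eG; apply: eq_in_imfset => // x xe.
  apply: fg; have [H _ _ _] := aG; have [p [q epq]] := H e eG; subst e.
  by move: xe; rewrite /= !inE => /orP[]/eqP->; [exact: anb_vert eG|exact: anb_vert2 eG].
apply: eq_in_imfset => // -[x y] /(bedge_verts bG)[xG yG] /=.
by rewrite !fg.
Qed.

Lemma relabel_id G : relabel id G = G.
Proof.
case: G => V A B; congr Graph => /=; rewrite ?imfset_id //.
  rewrite -[RHS]imfset_id; apply: eq_imfset => // e; exact: imfset_id.
by rewrite -[RHS]imfset_id; apply: eq_imfset => // -[].
Qed.

(** Relabelings are taken injective on all of [nat], which makes membership reflect at every number.
    Maps such as [rank], injective only on a vertex set, have to be extended first. *)
Lemma extend_inj (V : {fset nat}) (f : nat -> nat) : {in V &, injective f} ->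
  exists g, injective g /\ {in V, g =1 f}.
Proof.
move=> fI; pose M := \max_(v <- V) f v.
have fM x : x \in V -> (f x <= M)%N by move=> xV; exact: leq_bigmax_seq.
(* Outside [V], the shift by [M.+1] lands above every value of [f] on [V]. *)
exists (fun x => if x \in V then f x else x + M.+1)%N; split; last first.
  by move=> x ->.
move=> x y /=; case: ifP => xV; case: ifP => yV.
- exact: fI.
- by have := fM x xV; lia.
- by have := fM y yV; lia.
by move/addIn.
Qed.

Lemma left_inverse_inj (g : nat -> nat) (V : {fset nat}) : injective g ->
  exists h, injective h /\ {in V, cancel g h}.
Proof.
move=> gI; pose h0 y := nth 0%N V (index y [seq g v | v <- V]).
have h0K : {in V, cancel g h0}.
  by move=> x xV; rewrite /h0 index_map // nth_index.
have [|h [hI hE]] := @extend_inj (img g V) h0.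
  by move=> X Y /imgP[x -> xV] /imgP[y -> yV]; rewrite !h0K // => ->.
by exists h; split=> // x xV; rewrite hE ?mem_img ?h0K.
Qed.

Lemma relabelK g h G : wf G -> {in verts G, cancel g h} ->
  relabel h (relabel g G) = G.
Proof.
by move=> wG K; rewrite relabel_comp -[RHS]relabel_id; exact: relabel_eq.
Qed.

(** An injective left inverse carries any move of the relabeled graph back to [G]. *)
Lemma terminal_relabel g G : injective g -> wf G -> terminal G ->
  terminal (relabel g G).
Proof.
move=> gI wG tG H m; have [h [hI hK]] := left_inverse_inj (verts G) gI.
by have := move_relabel hI m; rewrite relabelK // => /tG.
Qed.

Lemma card_relabel g G : {in verts G &, injective g} ->
  #|` verts (relabel g G)| = #|` verts G|.
Proof. by move=> gI; rewrite /= card_in_imfset. Qed.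

Lemma rank_inj (V : {fset nat}) : {in V &, injective (rank V)}.
Proof.
have mono x y : y \in V -> (x < y)%N -> (rank V x < rank V y)%N.
  move=> yV xy; apply: fproper_ltn_card; rewrite fproperE; apply/andP; split.
    by apply/fsubsetP=> z; rewrite !inE /= => /andP[->] /=; lia.
  by apply/fsubsetPn; exists y; rewrite !inE /= yV ?leqnn // -ltnNge.
move=> x y xV yV e; case: (ltngtP x y) => // h.
  by have := mono _ _ yV h; rewrite e ltnn.
by have := mono _ _ xV h; rewrite e ltnn.
Qed.

Lemma img_rank (V : {fset nat}) : img (rank V) V = labels #|` V|.
Proof.
apply/eqP; rewrite eqEfcard; apply/andP; split.
  apply/fsubsetP=> y /imgP[x -> xV]; rewrite !inE /= mem_iota add1n ltnS.
  rewrite cardfs_gt0; apply/andP; split.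
    by apply/fset0Pn; exists x; rewrite !inE /= xV leqnn.
  by apply: fsubset_leq_card; apply/fsubsetP=> z; rewrite !inE => /andP[].
rewrite {1}/labels card_imfset //= undup_id ?iota_uniq // size_iota.
by rewrite /img card_in_imfset //; exact: rank_inj.
Qed.

Lemma norm_relabel G : wf G -> exists g,
  [/\ injective g, {in verts G, g =1 rank (verts G)} & norm G = relabel g G].
Proof.
move=> wG; have [g [gI gE]] := extend_inj (@rank_inj (verts G)).
exists g; split=> //; rewrite /norm; apply: relabel_eq => // x xG.
by rewrite gE.
Qed.

Lemma wf_norm G : wf G -> wf (norm G).
Proof. by move=> wG; have [g [gI _ ->]] := norm_relabel wG; exact: wf_relabel. Qed.

Lemma terminal_norm G : wf G -> terminal G -> terminal (norm G).
Proof.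
by move=> wG; have [g [gI _ ->]] := norm_relabel wG; exact: terminal_relabel.
Qed.

Lemma verts_norm G : verts (norm G) = labels #|` verts G|.
Proof. exact: img_rank. Qed.

Lemma card_norm G : #|` verts (norm G)| = #|` verts G|.
Proof. exact/card_relabel/rank_inj. Qed.

(** * Silhouettes *)

Lemma card_le2 (V : {fset nat}) c d : V `<=` [fset c; d] -> (#|` V| <= 2)%N.
Proof.
move=> /fsubset_leq_card h; apply: leq_trans h _.
by rewrite cardfs2; case: (_ != _).
Qed.

Lemma card_ge3 (V : {fset nat}) x y z : uniq [:: x; y; z] ->
  x \in V -> y \in V -> z \in V -> (2 < #|` V|)%N.
Proof.
move=> u xV yV zV; rewrite -[3]/(size [:: x; y; z]).
by apply: uniq_leq_size => // t; rewrite !inE => /or3P[]/eqP->.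
Qed.

Section Terminal.
Variable D : graph.
Hypotheses (wD : wf D) (tD : terminal D).

Let lD : locwf D. Proof. by case: wD. Qed.
Let cD : conn D. Proof. by case: wD. Qed.
Let bD : b_wf D. Proof. by case: lD. Qed.

Lemma terminal_step S U F : ~ step D S U F.
Proof. by move/step_move/tD. Qed.

Lemma terminal_b_loop v : b_loop D v -> anb D v v.
Proof.
move=> h; have [v' e] := anb_ex lD (proj1 (bedge_verts bD h)).
have [?|n] := pselect (v' = v); first by subst v'.
by case: (terminal_step (StepL3 h _ e)); exact: nesym.
Qed.

(** If the a-partners of [v] and [w] stay in the pair, the pair is closed under adjacency. Otherwise
    a lambda22-move applies when one of them carries an a-loop, a kappa3-move when neither does. *)
Lemma terminal_biso_sub v w : biso D v w -> verts D `<=` [fset v; w].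
Proof.
move=> b; have [vV wV] := badj_verts bD (biso_badj b).
have bC := iffLR (bisoC _ _ _) b.
have [v' e] := anb_ex lD vV; have [w' e'] := anb_ex lD wV.
have K : v' \in [fset v; w] -> w' \in [fset v; w] -> verts D `<=` [fset v; w].
  move=> v'T w'T; apply: (conn_sub cD vV); first by rewrite !inE eqxx.
  move=> p q /[!inE] /orP[]/eqP->; rewrite adjacentE => /orP[] k.
  - by rewrite (anb_fun lD k e); rewrite !inE in v'T.
  - by rewrite (biso_uniq b k) eqxx orbT.
  - by rewrite (anb_fun lD k e'); rewrite !inE in w'T.
  by rewrite (biso_uniq bC k) eqxx.
have [?|n1] := pselect (v' = v); have [?|n2] := pselect (w' = w); subst.
- by apply: K; rewrite !inE eqxx ?orbT.
- by case: (terminal_step (step_l22 lD e b e' (nesym n2))).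
- by case: (terminal_step (step_l22 lD e' bC e (nesym n1))).
have [?|n3] := pselect (w = v'); last first.
  by case: (terminal_step (step_k lD b e e' (nesym n1) (nesym n2) n3)).
subst v'; apply: K; first by rewrite !inE eqxx orbT.
by rewrite anbC in e; rewrite (anb_fun lD e' e) !inE eqxx.
Qed.

Lemma b_loop_sub v : b_loop D v -> anb D v v -> verts D `<=` [fset v; v].
Proof.
move=> h e; apply: (conn_sub cD (anb_vert lD e)); first by rewrite !inE eqxx.
move=> p q /[!inE] /orP[]/eqP->; rewrite adjacentE => /orP[] k.
- by rewrite (anb_fun lD k e) eqxx.
- by rewrite (b_loop_uniq bD h k) eqxx.
- by rewrite (anb_fun lD k e) eqxx.
by rewrite (b_loop_uniq bD h k) eqxx.
Qed.

Lemma terminal_triangle x y : (2 < #|` verts D|)%N -> (x, y) \in bedges D ->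
  exists u, b_triangle D x y u.
Proof.
move=> c /[dup] xy /(b_wf_iso_or bD)[e|b|//].
  subst y; have := card_le2 (b_loop_sub xy (terminal_b_loop xy)).
  by rewrite leqNgt c.
by have := card_le2 (terminal_biso_sub (or_introl b)); rewrite leqNgt c.
Qed.

(** All b-edges lie on triangles here, so an a-loop would permit a lambda21-move. *)
Lemma terminal_a_loop x : (2 < #|` verts D|)%N -> ~ anb D x x.
Proof.
move=> c xx; have [y] := b_ex bD (anb_vert lD xx).
case/orP=> /(terminal_triangle c)[u t].
  exact: terminal_step (StepL21 xx (b_tri_rot (b_tri_rot t))).
exact: terminal_step (StepL21 xx t).
Qed.

End Terminal.

Lemma graph_ext G H : locwf G -> locwf H -> verts G = verts H ->
  (forall x y, anb G x y = anb H x y) ->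
  (forall x y, ((x, y) \in bedges G) = ((x, y) \in bedges H)) -> G = H.
Proof.
case: G H => [V A B] [V' A' B'] [[/= H1 _ _ _] _] [[/= H1' _ _ _] _] -> a b.
congr Graph; apply/fsetP; last by case=> x y; exact: b.
move=> e; apply/idP/idP => eA; [have := H1 e eA|have := H1' e eA].
  by move=> [x [y exy]]; subst e; have := a x y; rewrite /anb /= eA.
by move=> [x [y exy]]; subst e; have := a x y; rewrite /anb /= eA.
Qed.

(** The type of one b-edge decides: a b-loop gives [Delta1]; an isolated b-edge gives [Delta2],
    since [exc] rules out [Delta3]; a triangle has too many vertices. *)
Lemma terminal_small D : wf D -> terminal D -> (#|` verts D| <= 2)%N ->
  (exists v, D = Delta1 v) \/ (exists v w, v <> w /\ D = Delta2 v w).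
Proof.
move=> wD tD c; have [[ne _] lD] := wD; have [aD bD] := lD.
have /eqP/fset0Pn[x xV] := ne; have [y xy] := b_ex bD xV.
have {x xV y xy} [v [w vw]] : exists v w, (v, w) \in bedges D.
  by case/orP: xy => h; [exists x, y|exists y, x].
have pairs := let: And4 h _ _ _ := aD in h.
have [vV wV] := bedge_verts bD vw.
have [?|b|[u [u1 u2 u3 _]]] := b_wf_iso_or bD vw.
- subst w; left; exists v; have e := terminal_b_loop wD tD vw.
  have VE : verts D = [fset v].
    apply/eqP; rewrite eqEfsubset fsub1set vV andbT -fset1_2.
    exact: b_loop_sub.
  have [_ lv] := wf_Delta1 v; apply: graph_ext => //.
    move=> p q; rewrite /anb /=; apply/idP/idP => [pq|].
      have := anb_vert lD pq; have := anb_vert2 lD pq.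
      by rewrite VE !inE => /eqP-> /eqP->; rewrite fset1_2 eqxx.
    by rewrite inE -(fset1_2 v) => /eqP->.
  move=> p q; apply/idP/idP => [pq|].
    have := bedge_verts bD pq.
    by rewrite VE !inE => -[/eqP-> /eqP->].
  by rewrite inE => /eqP[-> ->].
- have n := biso_neq (or_introl b).
  have VE : verts D = [fset v; w].
    apply/eqP; rewrite eqEfsubset (terminal_biso_sub wD tD (or_introl b)).
    by apply/fsubsetP=> t; rewrite !inE => /orP[]/eqP->.
  have BE : bedges D = [fset (v, w)].
    apply/fsetP=> f; rewrite in_fset1; apply/idP/eqP => [fD|->//].
    case: f fD => p q pq; have [pV _] := bedge_verts bD pq.
    have [_ _] := b; apply => //=; move: pV.
    by rewrite VE !inE => /orP[]/eqP->; rewrite eqxx ?orbT.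
  have AE (X : {fset {fset nat}}) : (forall e, e \in X -> e \in aedges D) ->
      (forall x y, anb D x y -> [fset x; y] \in X) -> aedges D = X.
    move=> h1 h2; apply/fsetP=> e; apply/idP/idP => [eD|/h1//].
    by have [x [y exy]] := pairs e eD; subst e; exact: h2.
  have [v' e] := anb_ex lD vV; have [w' e'] := anb_ex lD wV.
  have eta : D = Graph (verts D) (aedges D) (bedges D) by case: (D).
  have v'V : v' \in [fset v; w] by rewrite -VE; exact: anb_vert2 e.
  have w'V : w' \in [fset v; w] by rewrite -VE; exact: anb_vert2 e'.
  move: v'V w'V; rewrite !inE => /orP[]/eqP ? /orP[]/eqP ?; subst v' w'.
  + by case: n; exact: (anb_inj lD e e').
  + have A2 : aedges D = [fset [fset v]; [fset w]].
      apply: AE => [f|x y xy].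
        by rewrite !inE => /orP[]/eqP->; rewrite -/(a_loop D _) a_loopE.
      have := anb_vert lD xy; rewrite VE !inE => /orP[]/eqP ?; subst x.
        by rewrite (anb_fun lD xy e) fset1_2 eqxx.
      by rewrite (anb_fun lD xy e') fset1_2 eqxx orbT.
    case: (tD (Delta1 v)); do 4 right; exists v, w; split=> //.
    by rewrite eta VE BE A2.
  + have A2 : aedges D = [fset [fset v; w]].
      apply: AE => [f|x y xy]; first by rewrite inE => /eqP->.
      have := anb_vert lD xy; rewrite VE !inE => /orP[]/eqP ?; subst x.
        by rewrite (anb_fun lD xy e).
      by rewrite (anb_fun lD xy e') fsetUC.
    by right; exists v, w; split=> //; rewrite eta VE BE A2.
  by case: n; exact: (anb_inj lD e e').
by have := card_ge3 u1 vV wV (proj2 (bedge_verts bD u3)); rewrite ltnNge c.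
Qed.

Lemma same_silhC D D' : same_silh D D' -> same_silh D' D.
Proof.
case=> [->|[v [v' [-> ->]]]|[v [w [v' [w' [n n' -> ->]]]]]].
- by constructor 1.
- by constructor 2; exists v', v.
by constructor 3; exists v', w', v, w.
Qed.

Lemma same_silh_trans D1 D2 D3 :
  same_silh D1 D2 -> same_silh D2 D3 -> same_silh D1 D3.
Proof.
have N v x y : x <> y -> Delta1 v <> Delta2 x y.
  move=> n h; have := congr1 (fun G => #|` verts G|) h.
  by rewrite /= cardfs1 cardfs2 (introN eqP n).
case=> [->//|[v [v' [-> ->]]]|[v [w [v' [w' [n n' -> ->]]]]]].
  case=> [<-|[x [y [_ ->]]]|[x [y [x' [y' [m _ /N h _]]]]]].
  - by constructor 2; exists v, v'.
  - by constructor 2; exists v, y.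
  by case: h.
case=> [<-|[x [y [h _]]]|[x [y [x' [y' [m m' _ ->]]]]]].
- by constructor 3; exists v, w, v', w'.
- by case: (N x v' w' n').
by constructor 3; exists v, w, x', y'.
Qed.

Lemma same_silh_small D D' : wf D -> terminal D -> wf D' -> terminal D' ->
  #|` verts D| = #|` verts D'| -> (#|` verts D| <= 2)%N -> same_silh D D'.
Proof.
move=> wD tD wD' tD' e c; have c' := c; rewrite e in c'.
have [[v h]|[v [w [n h]]]] := terminal_small wD tD c;
have [[v' h']|[v' [w' [n' h']]]] := terminal_small wD' tD' c'; subst.
- by constructor 2; exists v, v'.
- by move: e; rewrite /= cardfs1 cardfs2 (introN eqP n').
- by move: e; rewrite /= cardfs1 cardfs2 (introN eqP n).
by constructor 3; exists v, w, v', w'.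
Qed.

Lemma same_silh_large D D' : (2 < #|` verts D'|)%N ->
  same_silh D D' <-> D = D'.
Proof.
move=> c; split=> [|->]; last by constructor 1.
case=> [//|[v [v' [_ h]]]|[v [w [v' [w' [_ _ _ h]]]]]];
  by move: c; rewrite h /= ?cardfs1 // cardfs2; case: (_ != _).
Qed.

Lemma in_graphs_on G : wf G -> G \in graphs_on (verts G).
Proof.
move=> [_ [[H1 H2 _ _] bG]]; apply/imfsetP; exists (aedges G, bedges G) => /=; last by case: G {H1 H2 bG}.
rewrite !inE /=; apply/andP; split.
  rewrite fpowersetE; apply/fsubsetP=> e eG; rewrite fpowersetE.
  have [x [y exy]] := H1 e eG; subst e; apply/fsubsetP=> z.
  rewrite !inE => /orP[]/eqP->; first exact: H2 eG.
  by apply: (H2 _ x); rewrite anbC.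
rewrite fpowersetE; apply/fsubsetP=> -[x y] /(bedge_verts bG)[xG yG].
by rewrite inE /= xG.
Qed.

Lemma graphs_on_verts G V : G \in graphs_on V -> verts G = V.
Proof. by case/imfsetP=> p _ ->. Qed.

Lemma frakGP n s G : reflect [/\ wf G, verts G = labels n
  & #|` verts (qsilh G)| = s] (G \in frakG n s).
Proof.
rewrite !inE /=; apply: (iffP idP).
  case/andP=> /graphs_on_verts e /andP[/asboolP/cyc_reducedP w /eqP c].
  by split=> //; rewrite -c; apply/esym/card_norm.
move=> [w e c]; rewrite -e in_graphs_on //=; apply/andP; split.
  exact/asboolP/cyc_reducedP.
by rewrite -c; apply/eqP/card_norm.
Qed.

Lemma card_labels n : #|` labels n| = n.
Proof. by rewrite /labels card_imfset //= undup_id ?iota_uniq // size_iota. Qed.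

(** A graph of size [s] whose quasi-silhouette has [s] vertices has lost none of them, so it equals
    its quasi-silhouette. *)
Lemma frakDP s D : reflect [/\ wf D, terminal D & verts D = labels s]
  (D \in frakD s s).
Proof.
apply: (iffP idP).
  case/imfsetP=> G /= /frakGP[w e c] ->.
  have t := qsilh_terminal w; suff E : qsilh G = G by rewrite E in t *.
  apply: reduces_card_eq (qsilh_reduces w) _ => //.
  by rewrite c e card_labels.
move=> [w t e]; apply/imfsetP; exists D; rewrite /= ?qsilh_id //.
by apply/frakGP; rewrite qsilh_id // e card_labels.
Qed.

Lemma silh_frakD n s G : G \in frakG n s -> silh G \in frakD s s.
Proof.
case/frakGP=> w e c; apply/frakDP; rewrite /silh; split.
- exact/wf_norm/qsilh_wf.
- by apply: terminal_norm; [exact: qsilh_wf|exact: qsilh_terminal].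
by rewrite verts_norm c.
Qed.

(** * Exchanging silhouettes *)

Definition swap_b (E E' G : graph) : graph :=
  Graph (verts G) (aedges G) ((bedges G `\` bedges E) `|` bedges E').

Lemma b_tri_in_out F x : wf F ->
  (forall x y, (x, y) \in bedges F -> exists u, b_triangle F x y u) ->
  x \in verts F ->
  (exists y, (x, y) \in bedges F) /\ (exists z, (z, x) \in bedges F).
Proof.
move=> [_ [_ bF]] t /(b_ex bF)[y /orP[]xy]; have [u [_ _ h1 h2]] := t _ _ xy.
  by split; [exists y|exists u].
by split; [exists u|exists y].
Qed.

Section Swap.
Variables E E' : graph.
Hypotheses (wE : wf E) (wE' : wf E') (vE : verts E' = verts E).
Hypothesis triE : forall x y, (x, y) \in bedges E -> exists u, b_triangle E x y u.
Hypothesis triE' :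
  forall x y, (x, y) \in bedges E' -> exists u, b_triangle E' x y u.

Let bE : b_wf E. Proof. by case: wE => _ []. Qed.
Let bE' : b_wf E'. Proof. by case: wE' => _ []. Qed.

Section Contains.
Variable G : graph.
Hypotheses (lG : locwf G) (GE : bedges E `<=` bedges G).

Let bG : b_wf G. Proof. by case: lG. Qed.

Let sub x y : (x, y) \in bedges E -> (x, y) \in bedges G.
Proof. exact: (fsubsetP GE). Qed.

(** Each vertex of [E] already has an incoming and an outgoing b-edge in [E]. The b-edges of [G]
    form a partial injection, so none of them crosses the boundary of [verts E]. *)
Lemma bedge_in_E x y : (x, y) \in bedges G -> (x \in verts E) = (y \in verts E).
Proof.
move=> xy; apply/idP/idP.
  case/(b_tri_in_out wE triE)=> -[z xz] _.
  by rewrite (bedge_fun bG xy (sub xz)); exact: (proj2 (bedge_verts bE xz)).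
case/(b_tri_in_out wE triE)=> _ [z zy].
by rewrite (bedge_inj bG xy (sub zy)); exact: (proj1 (bedge_verts bE zy)).
Qed.

Lemma bedge_E x y : x \in verts E ->
  ((x, y) \in bedges E) = ((x, y) \in bedges G).
Proof.
case/(b_tri_in_out wE triE)=> -[z xz] _; apply/idP/idP => [/sub//|xy].
by rewrite (bedge_fun bG xy (sub xz)).
Qed.

Lemma bedge_swap x y : ((x, y) \in bedges (swap_b E E' G)) =
  if x \in verts E then (x, y) \in bedges E' else (x, y) \in bedges G.
Proof.
rewrite /= !inE; case: ifP => xE.
  by rewrite -(bedge_E _ xE); case: (_ \in bedges E).
have -> : ((x, y) \in bedges E') = false.
  by apply/negP=> /(bedge_verts bE')[]; rewrite vE xE.
have -> : ((x, y) \in bedges E) = false.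
  by apply/negP=> /(bedge_verts bE)[]; rewrite xE.
by rewrite orbF.
Qed.

Lemma bedge_swap_in x y : (x, y) \in bedges (swap_b E E' G) ->
  (x \in verts E) = (y \in verts E).
Proof.
rewrite bedge_swap; case: ifP => [xE|xE].
  by move=> /(bedge_verts bE')[_]; rewrite vE => ->.
by move/bedge_in_E; rewrite xE.
Qed.

Lemma bedge_swap_out x y : x \notin verts E ->
  ((x, y) \in bedges (swap_b E E' G)) = ((x, y) \in bedges G).
Proof. by rewrite bedge_swap => /negbTE->. Qed.

Lemma b_iso_swap x y : b_isolated G x y -> x \notin verts E ->
  b_isolated (swap_b E E' G) x y.
Proof.
move=> [n xy H] xE; have yE : y \notin verts E by rewrite -(bedge_in_E xy).
split; rewrite ?bedge_swap_out // => -[p q] pq h; apply: (H) => //.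
move: (pq); rewrite bedge_swap; case: ifP => // pE _.
have qE := bedge_swap_in pq; rewrite pE in qE.
by case/or4P: h => /= /eqP ?; subst; rewrite ?pE -?qE in xE yE.
Qed.

Lemma b_tri_swap x y z : b_triangle G x y z -> x \notin verts E ->
  b_triangle (swap_b E E' G) x y z.
Proof.
move=> [u xy yz zx] xE; have yE : y \notin verts E by rewrite -(bedge_in_E xy).
have zE : z \notin verts E by rewrite -(bedge_in_E yz).
by split; rewrite ?bedge_swap_out.
Qed.

Hypothesis VG : verts E `<=` verts G.

Lemma locwf_swap : locwf (swap_b E E' G).
Proof.
split; first by case: lG.
split.
- move=> x y; rewrite bedge_swap; case: ifP => _.
    move=> /(bedge_verts bE'); rewrite vE => -[? ?].
    by split; exact: (fsubsetP VG).
  exact: (@bedge_verts _ bG x y).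
- split=> x y z.
    by rewrite !bedge_swap; case: ifP => _; [exact: (bedge_fun bE')|exact: (bedge_fun bG)].
  move=> h h'; have e := bedge_swap_in h; have e' := bedge_swap_in h'.
  move: h h'; rewrite !bedge_swap e e'; case: ifP => _.
    exact: (bedge_inj bE').
  exact: (bedge_inj bG).
- move=> x xG; have [xE|xE] := boolP (x \in verts E).
    have [[y xy] _] : (exists y, (x, y) \in bedges E') /\
        (exists z, (z, x) \in bedges E') by apply: b_tri_in_out; rewrite ?vE.
    by exists y; left; rewrite bedge_swap xE.
  have [y /orP[]xy] := b_ex bG xG; exists y.
    by left; rewrite bedge_swap_out.
  by right; rewrite bedge_swap_out // (bedge_in_E xy).
move=> x y h; move: (h); rewrite bedge_swap; case: ifP => [xE /triE'[u t]|xE].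
  constructor 3; exists u; case: t => u' xy yz zx.
  have yE : y \in verts E by rewrite -vE; case: (bedge_verts bE' xy).
  have uE : u \in verts E by rewrite -vE; case: (bedge_verts bE' yz).
  by split; rewrite ?bedge_swap ?xE ?yE ?uE.
move=> xy; case: (b_wf_iso_or bG xy).
- by constructor 1.
- by move=> b; constructor 2; apply: b_iso_swap; rewrite ?xE.
by move=> [u t]; constructor 3; exists u; apply: b_tri_swap; rewrite ?xE.
Qed.

(** Every b-edge used by a move lies in the b-component of a deleted vertex, hence outside
    [verts E], where the exchange changes nothing. *)
Lemma step_swap S U F : step G S U F -> (forall u, u \in U -> u \notin verts E) ->
  step (swap_b E E' G) S U F.
Proof.
have iso x y : biso G x y -> x \notin verts E -> biso (swap_b E E' G) x y.
  move=> [b|b] xE; [left|right]; apply: b_iso_swap => //.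
  by have [_ yx _] := b; rewrite (bedge_in_E yx).
case.
- move=> v w h n e H; apply: StepL3 => //.
  by rewrite /b_loop bedge_swap_out //; apply: H; rewrite inE.
- move=> v w w' a t H; apply: StepL21 => //; apply: b_tri_swap => //.
  by have [_ wv _ _] := t; rewrite (bedge_in_E wv); apply: H; rewrite inE.
- move=> v w w' a b e n1 n2 H; apply: StepL22 => //.
  by apply: iso => //; apply: H; rewrite !inE eqxx.
move=> v w v' w' b e e' n1 n2 n3 n4 n5 H; apply: StepK => //.
by apply: iso => //; apply: H; rewrite !inE eqxx.
Qed.

Lemma swap_cut U F : (forall u, u \in U -> u \notin verts E) ->
  swap_b E E' (cut U F G) = cut U F (swap_b E E' G).
Proof.
move=> H; congr Graph; apply/fsetP=> e; rewrite !inE /=.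
case eE: (e \in bedges E') => /=; last first.
  by rewrite !orbF andbA.
rewrite !orbT; case: e eE => x y /(bedge_verts bE')[]; rewrite vE /= => xE yE.
by apply/esym/andP; split; apply/negP=> /H; rewrite ?xE ?yE.
Qed.

End Contains.

Hypothesis aE : aedges E' = aedges E.
Hypothesis cardE : (2 < #|` verts E|)%N.

Lemma swap_self : swap_b E E' E = E'.
Proof. by rewrite /swap_b fsetDv fset0U -aE -vE; case: (E'). Qed.

(** Induction upwards from [E], which [swap_b] turns into [E']. Each preceding move is also a move
    of the exchanged graph, and connectedness climbs from [E'] by [conn_step]. *)
Lemma reduces_swap G : wf G -> reduces G E -> [/\ bedges E `<=` bedges G,
  verts E `<=` verts G, reduces (swap_b E E' G) E' & conn (swap_b E E' G)].
Proof.
(* The end of the reduction is generalised so that the induction leaves the section variable [E]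
   alone. *)
move=> + r; have [H eH] : exists H, H = E by exists E.
rewrite -{1}eH in r; elim: r eH => {G H} [G -> wG|G G1 H m _ IH eH wG].
  rewrite swap_self; split; [exact: fsubset_refl|exact: fsubset_refl|exact: rt1n_refl|].
  by case: wE'.
have wG1 := move_wf wG m; have [i1 i2 r c] := IH eH wG1.
case/moveP: m => [[S [U [F [st e]]]]|[v [w [_ _ e]]]]; last first.
  (* A move [exc] would leave a single vertex, too few to contain [verts E]. *)
  have := leq_trans cardE (fsubset_leq_card i2).
  by rewrite e /= cardfs1.
have UE u : u \in U -> u \notin verts E.
  move=> uU; apply/negP=> /(fsubsetP i2).
  by rewrite e vert_cut uU.
have [_ lG] := wG.
have j1 : bedges E `<=` bedges G.
  by apply: fsubset_trans i1 _; rewrite e; apply/fsubsetP=> f; rewrite !inE => /andP[].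
have j2 : verts E `<=` verts G.
  by apply: fsubset_trans i2 _; rewrite e; exact: fsubsetDl.
have st' := step_swap lG j1 st UE.
rewrite e swap_cut // in r c; split=> //; first exact: rt1n_trans (step_move st') r.
by apply/(conn_step _ st') => //; exact: locwf_swap.
Qed.

Lemma wf_swap G : wf G -> reduces G E -> wf (swap_b E E' G).
Proof.
move=> wG r; have [i1 i2 _ c] := reduces_swap wG r; split=> //.
by apply: locwf_swap => //; case: wG.
Qed.

(** At the vertices of [E] both graphs have the b-edges of [E]; elsewhere the exchange keeps the
    b-edges visible. *)
Lemma swap_inj G H : wf G -> wf H -> reduces G E -> reduces H E ->
  swap_b E E' G = swap_b E E' H -> G = H.
Proof.
move=> wG wH rG rH e; have [_ lG] := wG; have [_ lH] := wH.
have [i1 _ _ _] := reduces_swap wG rG; have [j1 _ _ _] := reduces_swap wH rH.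
apply: graph_ext => //.
- exact: (congr1 verts e).
- by move=> x y; rewrite /anb; have /= -> := congr1 aedges e.
move=> x y; have [xE|xE] := boolP (x \in verts E).
  by rewrite -(bedge_E lG i1 _ xE) -(bedge_E lH j1 _ xE).
by rewrite -(bedge_swap_out lG i1 _ xE) -(bedge_swap_out lH j1 _ xE) e.
Qed.

End Swap.

(** * Perfect matchings as fixed-point-free involutions *)

Definition involution_on (A : {fset nat}) (a : nat -> nat) := forall x, x \in A ->
  [/\ a x \in A, a x <> x & a (a x) = x].

Lemma card_involution A a : involution_on A a ->
  #|` A| = (2 * #|` [fset x in A | (x < a x)%N]|)%N.
Proof.
move=> H; set T := [fset x in A | (x < a x)%N].
have TA : T `<=` A by apply/fsubsetP=> x; rewrite !inE => /andP[].
rewrite -(cardfsID T A) (fsetIidPr TA) mul2n -addnn; congr (_ + _)%N.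
have -> : A `\` T = img a T.
  apply/fsetP=> x; apply/idP/idP.
    rewrite !inE /= => /andP[+ xA]; rewrite xA /= -leqNgt => ax.
    have [axA n e] := H x xA; rewrite -e; apply/imfsetP; exists (a x) => //.
    by rewrite !inE /= axA e ltn_neqAle ax andbT; apply/eqP.
  case/imgP=> y ->; rewrite !inE /= => /andP[/H[yA n e] h].
  by rewrite yA e /= andbT -leqNgt ltnW.
rewrite /img card_in_imfset // => x y /=; rewrite !inE => /andP[/H[_ _ ex] _].
by move=> /andP[/H[_ _ ey] _] e; rewrite -ex -ey e.
Qed.

(** Both involutions have equally many pairs. The lower elements of the pairs are matched in list
    order and the upper ones are carried along. Being the identity off [A], the map can act on the
    labels of a larger graph. *)
Lemma involutions_conjugate A a a' : involution_on A a -> involution_on A a' ->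
  exists p : nat -> nat, [/\ injective p, forall x, x \in A -> p x \in A,
    forall x, x \notin A -> p x = x & forall x, x \in A -> p (a x) = a' (p x)].
Proof.
move=> H H'.
pose T := [fset x in A | (x < a x)%N]; pose T' := [fset x in A | (x < a' x)%N].
have cT : #|` T| = #|` T'|.
  by have := card_involution H; rewrite (card_involution H') -/T -/T'; lia.
have TA x : x \in T -> x \in A by rewrite !inE => /andP[].
have TA' x : x \in T' -> x \in A by rewrite !inE => /andP[].
have aT x : x \in A -> (a x \in T) = (x \notin T).
  move=> xA; have [axA n e] := H x xA; rewrite !inE /= axA xA e /= -leqNgt.
  by rewrite ltn_neqAle; case: eqP.
have aT' x : x \in A -> (a' x \in T') = (x \notin T').
  move=> xA; have [axA n e] := H' x xA; rewrite !inE /= axA xA e /= -leqNgt.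
  by rewrite ltn_neqAle; case: eqP.
pose g x := nth 0%N T' (index x T).
have gT x : x \in T -> g x \in T'.
  by move=> xT; apply: mem_nth; rewrite -cT index_mem.
have gI : {in T &, injective g}.
  move=> x y xT yT /eqP; rewrite nth_uniq ?fset_uniq -?cT ?index_mem // => /eqP h.
  by rewrite -(nth_index 0%N xT) h nth_index.
pose p x := if x \in T then g x else if x \in A then a' (g (a x)) else x.
have pT x : x \in A -> (p x \in A) /\ (p x \in T') = (x \in T).
  move=> xA; rewrite /p xA; case: ifP => xT.
    by rewrite gT // TA' // gT.
  have axT : g (a x) \in T' by apply: gT; rewrite aT ?xT.
  by have [? _ _] := H' _ (TA' _ axT); rewrite aT' ?axT // TA'.
have out x : x \notin A -> p x = x.
  by move=> xA; rewrite /p (negbTE xA); case: ifP => // /TA; rewrite (negbTE xA).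
exists p; split=> //; last first.
- move=> x xA; have [axA _ e] := H x xA; rewrite /p aT // axA xA e.
  case: (boolP (x \in T)) => xT //=.
  have axT : g (a x) \in T' by apply: gT; rewrite aT.
  by have [_ _ ->] := H' _ (TA' _ axT).
- by move=> x /pT[].
move=> x y e; have [xA|xA] := boolP (x \in A); have [yA|yA] := boolP (y \in A).
- have [_ px] := pT x xA; have [_ py] := pT y yA.
  have xyT : (x \in T) = (y \in T) by rewrite -px -py e.
  move: e; rewrite /p xA yA -xyT; case: ifP => xT; first by apply: gI; rewrite -?xyT.
  have axT : a x \in T by rewrite aT ?xT.
  have ayT : a y \in T by rewrite aT // -xyT xT.
  have [_ _ ex] := H x xA; have [_ _ ey] := H y yA.
  have [_ _ gx] := H' _ (TA' _ (gT _ axT)); have [_ _ gy] := H' _ (TA' _ (gT _ ayT)).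
  by move=> h; rewrite -ex -ey; congr a; apply: gI => //; rewrite -gx -gy h.
- by have := yA; rewrite -(out y yA) -e; have [-> _] := pT x xA.
- by have := xA; rewrite -(out x xA) e; have [-> _] := pT y yA.
by rewrite -(out x xA) -(out y yA).
Qed.

Lemma matching_involution D : wf D -> (forall x, ~ anb D x x) ->
  exists a, involution_on (verts D) a /\
    forall x, x \in verts D -> anb D x (a x).
Proof.
move=> [_ lD] na.
have /choice[a aP] : forall x, exists y, x \in verts D -> anb D x y.
  move=> x; have [/(anb_ex lD)[y h]|xD] := boolP (x \in verts D).
    by exists y.
  by exists 0%N.
exists a; split=> // x xD; have e := aP x xD.
split; first exact: anb_vert2 e.
  by move=> h; rewrite h in e; exact: na e.
have e' := aP (a x) (anb_vert2 lD e).
by rewrite anbC in e; exact: (anb_fun lD e' e).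
Qed.

Lemma img_eq_card (p : nat -> nat) (A : {fset nat}) : injective p ->
  (forall x, x \in A -> p x \in A) -> img p A = A.
Proof.
move=> pI pA; apply/eqP; rewrite eqEfcard; apply/andP; split.
  by apply/fsubsetP=> y /imgP[x -> /pA].
by rewrite /img card_imfset.
Qed.

(** After the permutation [p], the graph [E1] has the a-edges of [E'], so only b-edges remain to be
    exchanged. As [p] preserves [verts E] and fixes everything else, the label set is preserved. *)
Lemma transfer_map n E E' : wf E -> terminal E -> wf E' -> terminal E' ->
  verts E' = verts E -> (2 < #|` verts E|)%N ->
  exists Phi : graph -> graph,
    (forall G, wf G -> verts G = labels n -> qsilh G = E ->
       [/\ wf (Phi G), verts (Phi G) = labels n & qsilh (Phi G) = E']) /\
    (forall G H, wf G -> verts G = labels n -> qsilh G = E ->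
       wf H -> verts H = labels n -> qsilh H = E -> Phi G = Phi H -> G = H).
Proof.
move=> wE tE wE' tE' vE c; have c' := c; rewrite -vE in c'.
have na := fun x => @terminal_a_loop _ wE tE x c.
have na' := fun x => @terminal_a_loop _ wE' tE' x c'.
have [a [aI aP]] := matching_involution wE na.
have [a' [aI' aP']] := matching_involution wE' na'; rewrite vE in aI' aP'.
have [p [pI pA pout pa]] := involutions_conjugate aI aI'.
pose E1 := relabel p E.
have wE1 : wf E1 by exact: wf_relabel.
have tE1 : terminal E1 by exact: terminal_relabel.
have vE1 : verts E1 = verts E by exact: img_eq_card.
have [_ lE] := wE; have [_ lE'] := wE'; have [_ lE1] := wE1.
have vE'1 : verts E' = verts E1 by rewrite vE vE1.
have c1 : (2 < #|` verts E1|)%N by rewrite vE1.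
have anbE x y : anb E1 x y = anb E' x y.
  (* One inclusion suffices, since in both graphs each vertex has exactly one a-partner. *)
  have K : forall X Y, anb E1 X Y -> anb E' X Y.
    move=> X Y /anb_relabelP[//|u [v [-> -> uv]]].
    have uE := anb_vert lE uv; rewrite -(anb_fun lE (aP u uE) uv) pa //.
    exact/aP'/pA.
  apply/idP/idP => [/K//|xy].
  have xE1 : x \in verts E1 by rewrite -vE'1; exact: anb_vert xy.
  have [z xz] := anb_ex lE1 xE1.
  by rewrite (anb_fun lE' xy (K _ _ xz)).
have aE : aedges E' = aedges E1.
  have [[H _ _ _] _] := lE'; have [[H1 _ _ _] _] := lE1.
  apply/fsetP=> e; apply/idP/idP => h.
    by have [x [y exy]] := H e h; subst e; rewrite -/(anb E1 x y) anbE.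
  by have [x [y exy]] := H1 e h; subst e; rewrite -/(anb E' x y) -anbE.
have triE1 x y := @terminal_triangle _ wE1 tE1 x y c1.
have triE' x y := @terminal_triangle _ wE' tE' x y c'.
have red G : wf G -> qsilh G = E -> wf (relabel p G) /\ reduces (relabel p G) E1.
  move=> wG q; split; first exact: wf_relabel.
  by apply: reduces_relabel => //; rewrite -q; exact: qsilh_reduces.
exists (fun G => swap_b E1 E' (relabel p G)); split.
  move=> G wG vG q; have [wG1 r1] := red G wG q.
  have [_ _ r _] := reduces_swap wE1 wE' vE'1 triE1 triE' aE c1 wG1 r1.
  have w := wf_swap wE1 wE' vE'1 triE1 triE' aE c1 wG1 r1.
  split=> //; last exact: qsilh_uniq.
  rewrite /= -/(img p (verts G)) vG; apply: img_eq_card => // x xn.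
  have [/pA h|/pout->//] := boolP (x \in verts E).
  by rewrite -vG; apply: (fsubsetP (reduces_sub (qsilh_reduces wG))); rewrite q.
move=> G H wG vG qG wH vH qH /=.
have [wG1 rG] := red G wG qG; have [wH1 rH] := red H wH qH.
move/(swap_inj wE1 wE' vE'1 triE1 triE' aE c1 wG1 wH1 rG rH) => e.
have [h [_ hK]] := left_inverse_inj (labels n) pI.
by rewrite -(@relabelK p h G) ?vG // e relabelK ?vH.
Qed.

(** Such an [h] places a labeled graph on the vertex set [A], in a way that [norm] undoes. *)
Lemma unrank_ex (A : {fset nat}) :
  exists h, injective h /\ {in A, cancel (rank A) h}.
Proof.
have [g [gI gE]] := extend_inj (@rank_inj A).
have [h [hI hK]] := left_inverse_inj A gI.
by exists h; split=> // x xA; rewrite -gE // hK.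
Qed.

Lemma relabel_unrank E h : wf E -> {in verts E, cancel (rank (verts E)) h} ->
  relabel h (norm E) = E.
Proof. by move=> wE hK; rewrite /norm relabelK. Qed.

Lemma verts_relabel_unrank (A : {fset nat}) h D :
  {in A, cancel (rank A) h} -> verts D = labels #|` A| -> verts (relabel h D) = A.
Proof.
move=> hK; rewrite -img_rank /= => ->.
apply/fsetP=> x; apply/imfsetP/idP => /= [[y /imgP[z -> zA] ->]|xA].
  by rewrite hK.
by exists (rank A x); rewrite ?hK //; apply/imfsetP; exists x.
Qed.

Lemma norm_relabel_unrank (A : {fset nat}) h D : wf D ->
  {in A, cancel (rank A) h} -> verts D = labels #|` A| ->
  norm (relabel h D) = D.
Proof.
move=> wD hK vD; rewrite /norm (verts_relabel_unrank hK vD).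
apply: relabelK => // x; rewrite vD -img_rank => /imgP[y -> yA].
by rewrite hK.
Qed.

Lemma mem_fset_filter (T : choiceType) (A : {fset T}) (p : pred T) x :
  (x \in [fset y in A | p y]) = (x \in A) && p x.
Proof. by rewrite !inE. Qed.

(** A graph [G] over [D] is sent to one whose quasi-silhouette is [D'] placed on the vertices of
    [qsilh G]. The roles of [D] and [D'] can be exchanged, so the inequality yields equality. *)
Lemma card_silh_le n s D D' : (2 < s)%N -> D \in frakD s s -> D' \in frakD s s ->
  (#|` [fset G in frakG n s | `[< same_silh (silh G) D >]]| <=
   #|` [fset G in frakG n s | `[< same_silh (silh G) D' >]]|)%N.
Proof.
move=> s2 /frakDP[wD tD vD] /frakDP[wD' tD' vD'].
have cD : (2 < #|` verts D|)%N by rewrite vD card_labels.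
have cD' : (2 < #|` verts D'|)%N by rewrite vD' card_labels.
have /choice[h hP] := unrank_ex.
have hI A : injective (h A) by case: (hP A).
have hK A : {in A, cancel (rank A) (h A)} by case: (hP A).
(* The hypotheses are part of [tr] so that choice yields a map for every pair; where they fail, [id]
   serves as a dummy. *)
pose tr (p : graph * graph) (Phi : graph -> graph) :=
  wf p.1 -> terminal p.1 -> wf p.2 -> terminal p.2 ->
  verts p.2 = verts p.1 -> (2 < #|` verts p.1|)%N ->
    (forall G, wf G -> verts G = labels n -> qsilh G = p.1 ->
       [/\ wf (Phi G), verts (Phi G) = labels n & qsilh (Phi G) = p.2]) /\
    (forall G H, wf G -> verts G = labels n -> qsilh G = p.1 ->
       wf H -> verts H = labels n -> qsilh H = p.1 -> Phi G = Phi H -> G = H).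
have /choice[Phi PhiP] : forall p, exists Phi, tr p Phi.
  move=> p; have [h1|nh] := pselect ([/\ wf p.1, terminal p.1, wf p.2,
      terminal p.2 & verts p.2 = verts p.1 /\ (2 < #|` verts p.1|)%N]).
    have [w1 t1 w2 t2 [v c]] := h1.
    by have [F FP] := transfer_map n w1 t1 w2 t2 v c; exists F.
  by exists id => w1 t1 w2 t2 v c; case: nh.
pose E' G := relabel (h (verts (qsilh G))) D'.
pose F G := Phi (qsilh G, E' G) G.
have inS D0 G : (2 < #|` verts D0|)%N ->
    reflect [/\ wf G, verts G = labels n, #|` verts (qsilh G)| = s & silh G = D0]
    (G \in [fset G in frakG n s | `[< same_silh (silh G) D0 >]]).
  move=> c0; rewrite mem_fset_filter; apply: (iffP andP).
    by move=> [/frakGP[? ? ?] /asboolP h']; split=> //; apply/(same_silh_large _ c0).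
  move=> [? ? ? e]; split; first exact/frakGP.
  by apply/asboolP/(same_silh_large _ c0).
have P G : wf G -> verts G = labels n -> #|` verts (qsilh G)| = s ->
    [/\ verts (E' G) = verts (qsilh G), norm (E' G) = D'
      & tr (qsilh G, E' G) (Phi (qsilh G, E' G)) /\
        [/\ wf (qsilh G), terminal (qsilh G), wf (E' G) & terminal (E' G)]].
  move=> wG vG cG; have vD'2 : verts D' = labels #|` verts (qsilh G)| by rewrite cG.
  split; first exact: verts_relabel_unrank.
    exact: norm_relabel_unrank.
  split; first exact: PhiP.
  split; [exact: qsilh_wf|exact: qsilh_terminal|exact: wf_relabel|exact: terminal_relabel].
have FP G : wf G -> verts G = labels n -> #|` verts (qsilh G)| = s ->
    [/\ wf (F G), verts (F G) = labels n & qsilh (F G) = E' G].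
  move=> wG vG cG; have [v _ [t [w1 t1 w2 t2]]] := P G wG vG cG.
  by case: t => //=; rewrite ?cG // => + _; apply.
set S := [fset G in frakG n s | `[< same_silh (silh G) D >]].
have FI : {in S &, injective F}.
  move=> G H /(inS _ _ cD)[wG vG cG eG] /(inS _ _ cD)[wH vH cH eH] e.
  have [v _ [t [w1 t1 w2 t2]]] := P G wG vG cG.
  have [v' _ [_ [w1' _ _ _]]] := P H wH vH cH.
  have [_ _ qF] := FP G wG vG cG; have [_ _ qF'] := FP H wH vH cH.
  (* Equal images have equal quasi-silhouettes, so those of [G] and [H] share their vertex set. Both
     normalise to [D], hence they coincide, and the same transfer map was applied to [G] and [H]. *)
  have eE : E' G = E' H by rewrite -qF -qF' e.
  have eV : verts (qsilh G) = verts (qsilh H) by rewrite -v -v' eE.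
  have eq : qsilh G = qsilh H.
    rewrite -(relabel_unrank w1 (hK _)) -(relabel_unrank w1' (hK _)).
    by rewrite -!/(silh _) eG eH eV.
  case: t => //=; rewrite ?cG // => _ inj; apply: inj => //.
  by move: e; rewrite /F -eq -eE.
have <- : #|` [fset F G | G in S]| = #|` S| by rewrite card_in_imfset.
apply: fsubset_leq_card; apply/fsubsetP=> G' /imfsetP[G /= /(inS _ _ cD)[wG vG cG eG] ->].
have [v nE' _] := P G wG vG cG; have [wF vF qF] := FP G wG vG cG.
by apply/(inS _ _ cD'); split=> //; rewrite ?qF ?v // /silh qF.
Qed.

Theorem theorem3p4 (n s : nat) (hs : (1 <= s)%N) (hsn : (s <= n)%N)
    (hG : frakG n s <> fset0) :
  unif_prob (frakG n s) (fun G => silh G \in frakD s s) = 1%R /\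
  forall D D' : graph, D \in frakD s s -> D' \in frakD s s ->
    unif_prob (frakG n s) (fun G => same_silh (silh G) D) =
    unif_prob (frakG n s) (fun G => same_silh (silh G) D').
Proof.
split.
  rewrite /unif_prob.
  have -> : [fset G in frakG n s | `[< is_true (silh G \in frakD s s) >]] = frakG n s.
    apply/fsetP=> G; rewrite mem_fset_filter andb_idr // => GG.
    by apply/asboolP; exact: silh_frakD GG.
  by rewrite GRing.divff // Num.Theory.pnatr_eq0 cardfs_eq0; apply/eqP.
move=> D D' DD DD'; rewrite /unif_prob; congr (_%:R / _)%R.
have [s2|s2] := leqP s 2; last first.
  by apply/eqP; rewrite eqn_leq !card_silh_le.
have /frakDP[wD tD vD] := DD; have /frakDP[wD' tD' vD'] := DD'.
(* For [s] at most 2 the two events are the same, because [same_silh] does not separate [D] from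
   [D']. *)
have DD'S : same_silh D D'.
  by apply: same_silh_small; rewrite ?vD ?vD' ?card_labels.
congr (#|` _|)%N; apply/fsetP=> G; rewrite !mem_fset_filter; congr andb.
apply/asboolP/asboolP => h; apply: (same_silh_trans h) => //.
exact: same_silhC.
Qed.
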